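(* Let $V$ be a finite-dimensional representation of $Y_\hbar(\mathfrak g)$, and fix $i\in\mathbf I$. (1) If $\{V_1,\ldots,V_N\}$ are the simple factors in a composition series of $V$, then $\sigma_i(V)=\bigcup_{k=1}^N\sigma_i(V_k)$. (2) If $\{W_1,\ldots,W_M\}$ are the simple factors in a composition series for the $Y_{d_i\hbar}(\mathfrak{sl}_2)$-module $\varphi_i^*(V)$, then $$\sigma_i(V)=\bigcup_{k=1}^M\sigma(W_k)=\bigcup_{k=1}^M\mathsf Z(P_k(u)),$$ where $P_k(u)$ is the Drinfeld polynomial associated to $W_k$, i.e. $W_k\cong L(P_k)$.
   Context: Let $\mathfrak g$ be a finite-dimensional simple Lie algebra over $\mathbb C$ with Cartan subalgebra $\mathfrak h$, simple roots $\{\alpha_i\}_{i\in\mathbf I}$, invariant form $(\cdot,\cdot)$ normalized so that short roots have squared length $2$, Cartan matrix $a_{ij}=2(\alpha_i,\alpha_j)/(\alpha_i,\alpha_i)$, and $d_i=(\alpha_i,\alpha_i)/2$. Fix $\hbar\in\mathbb C^\times$. The Yangian $Y_\hbar(\mathfrak g)$ is the unital associative $\mathbb C$-algebra generated by $\xi_{i,r},x_{i,r}^\pm$ ($i\in\mathbf I$, $r\in\mathbb Z_{\ge0}$) with relations, for all $i,j\in\mathbf I$, $r,s\ge0$: $[\xi_{i,r},\xi_{j,s}]=0$; $[\xi_{i,0},x_{j,s}^\pm]=\pm d_ia_{ij}x_{j,s}^\pm$; $[\xi_{i,r+1},x_{j,s}^\pm]-[\xi_{i,r},x_{j,s+1}^\pm]=\pm\hbar\frac{d_ia_{ij}}2(\xi_{i,r}x_{j,s}^\pm+x_{j,s}^\pm\xi_{i,r})$;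 $[x^\pm_{i,r+1},x_{j,s}^\pm]-[x^\pm_{i,r},x_{j,s+1}^\pm]=\pm\hbar\frac{d_ia_{ij}}2(x^\pm_{i,r}x_{j,s}^\pm+x_{j,s}^\pm x^\pm_{i,r})$; $[x_{i,r}^+,x_{j,s}^-]=\delta_{ij}\xi_{i,r+s}$; and for $i\ne j$, $m=1-a_{ij}$, $\sum_{\pi\in S_m}[x^\pm_{i,r_{\pi(1)}},[x^\pm_{i,r_{\pi(2)}},\cdots[x^\pm_{i,r_{\pi(m)}},x^\pm_{j,s}]\cdots]]=0$. Set $\xi_i(u)=1+\hbar\sum_{r\ge0}\xi_{i,r}u^{-r-1}$, $x_i^\pm(u)=\hbar\sum_{r\ge0}x_{i,r}^\pm u^{-r-1}$. On a finite-dimensional representation $V$ these are expansions at $u=\infty$ of $\mathrm{End}(V)$-valued rational functions; $\sigma_i(V)\subset\mathbb C$ is the set of all poles of $\xi_i(u),x_i^+(u),x_i^-(u)$. For $\mathfrak{sl}_2$ the index $i$ is omitted. $\varphi_i:Y_{d_i\hbar}(\mathfrak{sl}_2)\to Y_\hbar(\mathfrak g)$ is the algebra homomorphism $\varphi_i(\xi(u))=\xi_i(u)$, $\varphi_i(x^\pm(u))=\sqrt{d_i}\,x_i^\pm(u)$, and $\varphi_i^*(V)$ is the pull-back of $V$. For a monic polynomial $P(u)$, $L(P)$ denotes the finite-dimensional irreducible $Y_{d_i\hbar}(\mathfrak{sl}_2)$-module generated by a nonzero $\Omega$ with $x^+(u)\Omega=0$ and $\xi(u)\Omega=\frac{P(u+d_i\hbar)}{P(u)}\Omega$;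 every finite-dimensional irreducible $Y_{d_i\hbar}(\mathfrak{sl}_2)$-module is isomorphic to a unique such $L(P)$. $\mathsf Z(P(u))$ is the set of roots of $P(u)$. *)

(* Defs.v *)
From HB Require Import structures.
From mathcomp Require Import all_boot all_order all_algebra perm.
From mathcomp Require Import complex ring.
From mathcomp Require Import boolp classical_sets reals.

Set Implicit Arguments.
Unset Strict Implicit.
Unset Printing Implicit Defensive.

Import Order.TTheory GRing.Theory Num.Theory.
Local Open Scope ring_scope.

Inductive aterm (K G : Type) : Type :=
| AGen of G
| AScal of K
| AAdd of aterm K G & aterm K G
| AMul of aterm K G & aterm K G.

Arguments AGen {K G}.
Arguments AScal {K G}.

Declare Scope aterm_scope.
Delimit Scope aterm_scope with A.
Bind Scope aterm_scope with aterm.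
Notation "t + u" := (AAdd t u) : aterm_scope.
Notation "t * u" := (AMul t u) : aterm_scope.
Notation "a *: t" := (AMul (AScal a) t) : aterm_scope.
Notation "t - u" := (AAdd t (AMul (AScal (-1)) u)) : aterm_scope.
Definition acomm (K : fieldType) (G : Type) (t u : aterm K G) : aterm K G :=
  t * u - u * t.

HB.instance Definition _ (K G : Type) := gen_eqMixin (aterm K G).
HB.instance Definition _ (K G : Type) := gen_choiceMixin (aterm K G).

(* The least congruence on terms that contains the axioms of a unital
   associative K-algebra and the relations rel. *)
Inductive acong (K : fieldType) (G : Type)
    (rel : aterm K G -> aterm K G -> Prop) : aterm K G -> aterm K G -> Prop :=
| acong_rel t u : rel t u -> acong rel t u
| acong_refl t : acong rel t t
| acong_sym t u : acong rel t u -> acong rel u t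
| acong_trans t u v : acong rel t u -> acong rel u v -> acong rel t v
| acong_add t t' u u' :
    acong rel t t' -> acong rel u u' -> acong rel (AAdd t u) (AAdd t' u')
| acong_mul t t' u u' :
    acong rel t t' -> acong rel u u' -> acong rel (AMul t u) (AMul t' u')
| acong_addA t u v : acong rel (AAdd t (AAdd u v)) (AAdd (AAdd t u) v)
| acong_addC t u : acong rel (AAdd t u) (AAdd u t)
| acong_add0 t : acong rel (AAdd (AScal 0) t) t
| acong_addN t : acong rel (AAdd (AMul (AScal (-1)) t) t) (AScal 0)
| acong_mulA t u v : acong rel (AMul t (AMul u v)) (AMul (AMul t u) v)
| acong_mul1l t : acong rel (AMul (AScal 1) t) t
| acong_mul1r t : acong rel (AMul t (AScal 1)) t
| acong_mulDl t u v :
    acong rel (AMul (AAdd t u) v) (AAdd (AMul t v) (AMul u v))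
| acong_mulDr t u v :
    acong rel (AMul t (AAdd u v)) (AAdd (AMul t u) (AMul t v))
| acong_scalD a b : acong rel (AScal (a + b)) (AAdd (AScal a) (AScal b))
| acong_scalM a b : acong rel (AScal (a * b)) (AMul (AScal a) (AScal b))
| acong_scalC a t : acong rel (AMul (AScal a) t) (AMul t (AScal a)).

Section PresentedAlgebra.
Variables (K : fieldType) (G : Type) (rel : aterm K G -> aterm K G -> Prop).

Definition acongb (t u : aterm K G) : bool := `[< acong rel t u >].

Fact acongb_equiv : equiv_class_of acongb.
Proof.
split=> [t|t u|u t v /asboolP tu /asboolP uv].
- exact/asboolP/acong_refl.
- by apply/asboolP/asboolP; exact: acong_sym.
- exact/asboolP/(acong_trans tu uv).
Qed.

Canonical acong_equiv := EquivRelPack acongb_equiv.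

Definition presalg : Type := {eq_quot acong_equiv}%qT.

HB.instance Definition _ := Choice.on presalg.
HB.instance Definition _ := Quotient.on presalg.

Definition pres_class (t : aterm K G) : presalg := (\pi_presalg t)%qT.

Lemma pres_classP t u : pres_class t = pres_class u <-> acong rel t u.
Proof.
by split=> [/eqquotP/asboolP //|tu]; apply/eqquotP/asboolP.
Qed.

Lemma pres_reprK (y : presalg) : pres_class (repr y)%qT = y.
Proof. exact: reprK. Qed.

Lemma pres_repr_class t : acong rel (repr (pres_class t))%qT t.
Proof. by apply/pres_classP; rewrite pres_reprK. Qed.

Definition pres_add (y z : presalg) := pres_class (AAdd (repr y)%qT (repr z)%qT).
Definition pres_mul (y z : presalg) := pres_class (AMul (repr y)%qT (repr z)%qT).
Definition pres_scalar (a : K) := pres_class (AScal a).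
Definition pres_opp (y : presalg) := pres_mul (pres_scalar (-1)) y.
Definition pres_scale (a : K) (y : presalg) := pres_mul (pres_scalar a) y.
Definition pres_gen (x : G) := pres_class (AGen x).

Lemma pres_addE t u :
  pres_add (pres_class t) (pres_class u) = pres_class (AAdd t u).
Proof. by apply/pres_classP/acong_add; exact: pres_repr_class. Qed.

Lemma pres_mulE t u :
  pres_mul (pres_class t) (pres_class u) = pres_class (AMul t u).
Proof. by apply/pres_classP/acong_mul; exact: pres_repr_class. Qed.

Let presW (Q : presalg -> Prop) : (forall t, Q (pres_class t)) -> forall y, Q y.
Proof. by move=> Qc y; rewrite -(pres_reprK y). Qed.

Fact pres_addA : associative pres_add.
Proof.
elim/presW=> t; elim/presW=> u; elim/presW=> v.
by rewrite !pres_addE; apply/pres_classP/acong_addA.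
Qed.
Fact pres_addC : commutative pres_add.
Proof.
elim/presW=> t; elim/presW=> u.
by rewrite !pres_addE; apply/pres_classP/acong_addC.
Qed.
Fact pres_add0 : left_id (pres_scalar 0) pres_add.
Proof. by elim/presW=> t; rewrite pres_addE; apply/pres_classP/acong_add0. Qed.
Fact pres_addN : left_inverse (pres_scalar 0) pres_opp pres_add.
Proof.
elim/presW=> t; rewrite /pres_opp pres_mulE pres_addE.
exact/pres_classP/acong_addN.
Qed.

HB.instance Definition _ := GRing.isZmodule.Build presalg
  pres_addA pres_addC pres_add0 pres_addN.

Fact pres_mulA : associative pres_mul.
Proof.
elim/presW=> t; elim/presW=> u; elim/presW=> v.
by rewrite !pres_mulE; apply/pres_classP/acong_mulA.
Qed.
Fact pres_mul1l : left_id (pres_scalar 1) pres_mul.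
Proof. by elim/presW=> t; rewrite pres_mulE; apply/pres_classP/acong_mul1l. Qed.
Fact pres_mul1r : right_id (pres_scalar 1) pres_mul.
Proof. by elim/presW=> t; rewrite pres_mulE; apply/pres_classP/acong_mul1r. Qed.
Fact pres_mulDl : left_distributive pres_mul +%R.
Proof.
elim/presW=> t; elim/presW=> u; elim/presW=> v.
rewrite /GRing.add /= !(pres_addE, pres_mulE).
exact/pres_classP/acong_mulDl.
Qed.
Fact pres_mulDr : right_distributive pres_mul +%R.
Proof.
elim/presW=> t; elim/presW=> u; elim/presW=> v.
rewrite /GRing.add /= !(pres_addE, pres_mulE).
exact/pres_classP/acong_mulDr.
Qed.

HB.instance Definition _ := GRing.Zmodule_isPzRing.Build presalg
  pres_mulA pres_mul1l pres_mul1r pres_mulDl pres_mulDr.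

Fact pres_scaleA a b y :
  pres_scale a (pres_scale b y) = pres_scale (a * b) y.
Proof.
rewrite /pres_scale pres_mulA pres_mulE; congr pres_mul.
exact/pres_classP/acong_sym/acong_scalM.
Qed.
Fact pres_scale1 : left_id 1 pres_scale.
Proof. exact: pres_mul1l. Qed.
Fact pres_scaleDr : right_distributive pres_scale +%R.
Proof. by move=> a y z; rewrite /pres_scale pres_mulDr. Qed.
Fact pres_scaleDl y : {morph pres_scale^~ y : a b / a + b}.
Proof.
move=> a b; rewrite /pres_scale -pres_mulDl; congr pres_mul.
rewrite /GRing.add /= pres_addE; exact/pres_classP/acong_scalD.
Qed.

HB.instance Definition _ := GRing.Zmodule_isLmodule.Build K presalg
  pres_scaleA pres_scale1 pres_scaleDr pres_scaleDl.

Fact pres_scaleAl (a : K) (y z : presalg) : a *: (y * z) = (a *: y) * z.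
Proof. exact: pres_mulA. Qed.

Fact pres_scaleAr (a : K) (y z : presalg) : a *: (y * z) = y * (a *: z).
Proof.
suff ac : pres_mul (pres_scalar a) y = pres_mul y (pres_scalar a).
  by rewrite [LHS]pres_mulA [RHS]pres_mulA ac.
move: y; elim/presW=> t; rewrite !pres_mulE.
exact/pres_classP/acong_scalC.
Qed.

End PresentedAlgebra.

Section Lift.
Variables (K : fieldType) (G : Type) (A : algType K) (f : G -> A).

Fixpoint aeval (t : aterm K G) : A :=
  match t with
  | AGen x => f x
  | AScal a => a%:A
  | AAdd t u => aeval t + aeval u
  | AMul t u => aeval t * aeval u
  end.

Variable rel : aterm K G -> aterm K G -> Prop.
Hypothesis rel_f : forall t u, rel t u -> aeval t = aeval u.

Lemma aeval_cong t u : acong rel t u -> aeval t = aeval u.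
Proof.
elim=> {t u} /=.
- exact: rel_f.
- by [].
- by move=> t u _ ->.
- by move=> t u v _ -> _ ->.
- by move=> t t' u u' _ -> _ ->.
- by move=> t t' u u' _ -> _ ->.
- by move=> t u v; rewrite addrA.
- by move=> t u; rewrite addrC.
- by move=> t; rewrite scale0r add0r.
- by move=> t; rewrite scaleN1r mulN1r addNr scale0r.
- by move=> t u v; rewrite mulrA.
- by move=> t; rewrite scale1r mul1r.
- by move=> t; rewrite scale1r mulr1.
- by move=> t u v; rewrite mulrDl.
- by move=> t u v; rewrite mulrDr.
- by move=> a b; rewrite scalerDl.
- by move=> a b; rewrite mulr_algl scalerA.
- by move=> a t; rewrite mulr_algl mulr_algr.
Qed.

Definition pres_lift (y : presalg rel) : A := aeval (repr y)%qT.

Lemma pres_liftE t : pres_lift (pres_class rel t) = aeval t.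
Proof. exact/aeval_cong/pres_repr_class. Qed.

Lemma pres_liftD y z : pres_lift (y + z) = pres_lift y + pres_lift z.
Proof. exact: pres_liftE. Qed.
Lemma pres_liftM y z : pres_lift (y * z) = pres_lift y * pres_lift z.
Proof. exact: pres_liftE. Qed.
Lemma pres_lift1 : pres_lift 1 = 1.
Proof. by rewrite [LHS]pres_liftE /= scale1r. Qed.
Lemma pres_liftZ a y : pres_lift (a *: y) = a *: pres_lift y.
Proof.
rewrite -{1}(pres_reprK y) [a *: _](pres_mulE _ (AScal a)) pres_liftE /=.
by rewrite mulr_algl.
Qed.
End Lift.

Inductive ygen (I : Type) : Type :=
| YXi of I & nat
| YX of bool & I & nat.   (* YX true = x^+, YX false = x^- *)

(* B is the Gram matrix of the simple roots, B i j = (alpha_i, alpha_j). *)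
Section YangianDef.
Variables (C : numClosedFieldType) (I : finType) (B : I -> I -> C) (hbar : C).

Definition cartan (i j : I) : C := 2 * B i j / B i i.
Definition dsym (i : I) : C := B i i / 2.
Definition pm (e : bool) : C := if e then 1 else -1.

Local Notation term := (aterm C (ygen I)).
Local Notation xi i r := (AGen (YXi i r) : term).
Local Notation x e i r := (AGen (YX e i r) : term).

Definition serre_term (e : bool) (i j : I) (m : nat) (r : 'I_m -> nat)
    (s : nat) (p : 'S_m) : term :=
  foldr (fun k t => acomm (x e i (r (p k))) t) (x e j s) (enum 'I_m).

Definition yang_coef (e : bool) (i j : I) : C :=
  pm e * (hbar * (dsym i * cartan i j) / 2).

Inductive yang_rel : term -> term -> Prop :=
| yang_xi_xi i j r s :
    yang_rel (acomm (xi i r) (xi j s)) (AScal 0)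
| yang_xi0_x e i j s :
    yang_rel (acomm (xi i 0%N) (x e j s))
      ((pm e * (dsym i * cartan i j)) *: x e j s)
| yang_xi_x e i j r s :
    yang_rel (acomm (xi i r.+1) (x e j s) - acomm (xi i r) (x e j s.+1))
      (yang_coef e i j *: (xi i r * x e j s + x e j s * xi i r))
| yang_x_x e i j r s :
    yang_rel (acomm (x e i r.+1) (x e j s) - acomm (x e i r) (x e j s.+1))
      (yang_coef e i j *: (x e i r * x e j s + x e j s * x e i r))
| yang_xp_xm i j r s :
    yang_rel (acomm (x true i r) (x false j s))
      (if i == j then xi i (r + s)%N else AScal 0)
| yang_serre e i j (m : nat) (r : 'I_m -> nat) s :
    i != j -> m%:R = 1 - cartan i j ->
    yang_rel (\big[@AAdd C (ygen I) / AScal 0]_(p : 'S_m) serre_term e i j r s p)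
      (AScal 0).

Definition Yangian : Type := presalg yang_rel.

HB.instance Definition _ := GRing.PzRing.on Yangian.
HB.instance Definition _ := GRing.Lmodule.on Yangian.

Lemma aeval_serre (A : algType C) (f : ygen I -> A) e i j m r s :
  aeval f (\big[@AAdd C (ygen I) / AScal 0]_(p : 'S_m) serre_term e i j r s p) =
  \sum_(p : 'S_m) aeval f (serre_term e i j r s p).
Proof.
by apply: (big_morph (aeval f)) => [t u|] /=; rewrite ?scale0r.
Qed.

Fact Yangian_neq0 : (1 : Yangian) != 0.
Proof.
pose f (_ : ygen I) : C^o := 0.
suff fE t u : yang_rel t u -> aeval f t = aeval f u.
  apply/eqP => /(congr1 (pres_lift f (rel := yang_rel))).
  rewrite pres_lift1 // [RHS](pres_liftE fE) /= scale0r => /eqP.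
  by rewrite oner_eq0.
case=> {t u} /= *; rewrite ?(mul0r, mulr0, addr0, add0r, scale0r, subr0) //.
  by case: ifP; rewrite //= scale0r.
rewrite aeval_serre big1 // => p _; rewrite /serre_term.
elim: (enum _) => [//|k l /= ->].
by rewrite !(mul0r, mulr0, addr0).
Qed.

HB.instance Definition _ :=
  GRing.PzSemiRing_isNonZero.Build Yangian Yangian_neq0.
HB.instance Definition _ := GRing.LSemiModule_isLSemiAlgebra.Build C Yangian
  (@pres_scaleAl _ _ yang_rel).
HB.instance Definition _ := GRing.LSemiAlgebra_isSemiAlgebra.Build C Yangian
  (@pres_scaleAr _ _ yang_rel).

Definition xi_gen (i : I) (r : nat) : Yangian := pres_gen yang_rel (YXi i r).
Definition x_gen (e : bool) (i : I) (r : nat) : Yangian :=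
  pres_gen yang_rel (YX e i r).
(* The coefficients of u^{-r} in xi_i(u) and x_i^{+-}(u). *)
Definition xi_series (i : I) (r : nat) : Yangian :=
  if r is r'.+1 then hbar *: xi_gen i r' else 1.
Definition x_series (e : bool) (i : I) (r : nat) : Yangian :=
  if r is r'.+1 then hbar *: x_gen e i r' else 0.

Lemma yang_relE t u : yang_rel t u ->
  aeval (pres_gen yang_rel : _ -> Yangian) t =
  aeval (pres_gen yang_rel : _ -> Yangian) u.
Proof.
suff ev v : aeval (pres_gen yang_rel : _ -> Yangian) v = pres_class yang_rel v.
  by move=> tu; rewrite !ev; apply/pres_classP/acong_rel.
elim: v => [//|a|t' IHt u' IHu|t' IHt u' IHu] /=; rewrite ?IHt ?IHu.
- by rewrite [LHS](pres_mulE _ (AScal a) (AScal 1)); apply/pres_classP/acong_mul1r.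
- exact: pres_addE.
- exact: pres_mulE.
Qed.

Lemma xi_xi i j r s :
  xi_gen i r * xi_gen j s - xi_gen j s * xi_gen i r = 0.
Proof.
by have := yang_relE (yang_xi_xi i j r s); rewrite /= mulr_algl scaleN1r scale0r.
Qed.

Lemma xi0_x e i j s :
  xi_gen i 0 * x_gen e j s - x_gen e j s * xi_gen i 0 =
  (pm e * (dsym i * cartan i j)) *: x_gen e j s.
Proof.
by have := yang_relE (yang_xi0_x e i j s); rewrite /= !mulr_algl scaleN1r.
Qed.

Lemma xi_x e i j r s :
  (xi_gen i r.+1 * x_gen e j s - x_gen e j s * xi_gen i r.+1) -
  (xi_gen i r * x_gen e j s.+1 - x_gen e j s.+1 * xi_gen i r) =
  yang_coef e i j *: (xi_gen i r * x_gen e j s + x_gen e j s * xi_gen i r).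
Proof.
by have := yang_relE (yang_xi_x e i j r s); rewrite /= !mulr_algl !scaleN1r.
Qed.

Lemma x_x e i j r s :
  (x_gen e i r.+1 * x_gen e j s - x_gen e j s * x_gen e i r.+1) -
  (x_gen e i r * x_gen e j s.+1 - x_gen e j s.+1 * x_gen e i r) =
  yang_coef e i j *: (x_gen e i r * x_gen e j s + x_gen e j s * x_gen e i r).
Proof.
by have := yang_relE (yang_x_x e i j r s); rewrite /= !mulr_algl !scaleN1r.
Qed.

Lemma xp_xm i j r s :
  x_gen true i r * x_gen false j s - x_gen false j s * x_gen true i r =
  if i == j then xi_gen i (r + s) else 0.
Proof.
have := yang_relE (yang_xp_xm i j r s); rewrite /= mulr_algl scaleN1r => ->.
by case: ifP; rewrite //= scale0r.
Qed.

End YangianDef.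

(* A single simple root, of squared length 2. *)
Definition sl2_gram (C : numClosedFieldType) (_ _ : unit) : C := 2.

Notation Yangian_sl2 hbar := (Yangian (@sl2_gram _) hbar).

Section Phi.
Variables (C : numClosedFieldType) (I : finType) (B : I -> I -> C) (hbar : C).
Variable (i : I).

Local Notation d := (dsym B i).

(* The series on the two sides carry the factors d_i * hbar and hbar, hence
   the division by d_i. *)
Definition phi_gen (z : ygen unit) : Yangian B hbar :=
  match z with
  | YXi _ r => d^-1 *: xi_gen B hbar i r
  | YX e _ r => (sqrtC d / d) *: x_gen B hbar e i r
  end.

Hypothesis Bi_neq0 : B i i != 0.

Lemma dsym_neq0 : d != 0.
Proof. by rewrite mulf_neq0 // invr_eq0 pnatr_eq0. Qed.

Lemma cartan_ii : cartan B i i = 2.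
Proof. by rewrite /cartan mulfK. Qed.

Lemma sl2_cartan j k : cartan (@sl2_gram C) j k = 2.
Proof. by rewrite /cartan /sl2_gram mulfK // pnatr_eq0. Qed.

Lemma sl2_dsym j : dsym (@sl2_gram C) j = 1.
Proof. by rewrite /dsym /sl2_gram divff // pnatr_eq0. Qed.

Lemma phi_gen_rel t u : yang_rel (@sl2_gram C) (d * hbar) t u ->
  aeval phi_gen t = aeval phi_gen u.
Proof.
have coefE e j k : yang_coef (@sl2_gram C) (d * hbar) e j k =
    yang_coef B hbar e i i.
  rewrite /yang_coef sl2_cartan sl2_dsym cartan_ii mul1r.
  by congr (_ * (_ / _)); rewrite -mulrA mulrCA.
case=> {t u} /=.
- move=> j k r s; rewrite mulr_algl scaleN1r scale0r.
  rewrite -!scalerAl -!scalerAr !scalerA -scalerBr.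
  by rewrite xi_xi scaler0.
- move=> e j k s; rewrite !mulr_algl scaleN1r.
  rewrite -!scalerAl -!scalerAr !scalerA (mulrC (_ / _) d^-1) -scalerBr.
  rewrite xi0_x scalerA sl2_cartan sl2_dsym cartan_ii mul1r; congr (_ *: _).
  by field; exact: dsym_neq0.
- move=> e j k r s; rewrite !mulr_algl !scaleN1r coefE.
  rewrite -!scalerAl -!scalerAr !scalerA (mulrC (_ / _) d^-1).
  by rewrite -!scalerBr -scalerDr xi_x scalerA mulrC -!scalerA.
- move=> e j k r s; rewrite !mulr_algl !scaleN1r coefE.
  rewrite -!scalerAl -!scalerAr !scalerA.
  by rewrite -!scalerBr -scalerDr x_x !scalerA mulrC.
- move=> [] [] r s; rewrite !mulr_algl !scaleN1r.
  rewrite -!scalerAl -!scalerAr !scalerA -scalerBr xp_xm eqxx.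
  congr (_ *: _); rewrite mulf_div -expr2 sqrtCK.
  by rewrite invfM mulrA divff ?mul1r ?dsym_neq0.
- by move=> e [] [].
Qed.

Definition phi_fun : Yangian_sl2 (d * hbar) -> Yangian B hbar :=
  pres_lift phi_gen (rel := yang_rel _ _).

Let phi_additive : zmod_morphism phi_fun.
Proof.
move=> y z; rewrite /phi_fun -[- z]scaleN1r (pres_liftD phi_gen_rel).
by rewrite (pres_liftZ phi_gen_rel) scaleN1r.
Qed.
Let phi_multiplicative : monoid_morphism phi_fun.
Proof. by split; [apply: pres_lift1 phi_gen_rel|apply: pres_liftM phi_gen_rel]. Qed.
Let phi_scalable : scalable phi_fun.
Proof. exact: pres_liftZ phi_gen_rel. Qed.

Definition phi : {lrmorphism Yangian_sl2 (d * hbar) -> Yangian B hbar} :=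
  HB.pack phi_fun
    (GRing.isZmodMorphism.Build _ _ phi_fun phi_additive)
    (GRing.isMonoidMorphism.Build _ _ phi_fun phi_multiplicative)
    (GRing.isScalable.Build _ _ _ _ phi_fun phi_scalable).

Lemma phi_xi_series r : phi (xi_series _ _ tt r) = xi_series B hbar i r.
Proof.
case: r => [|r]; first exact: (rmorph1 phi).
rewrite [xi_series _ _ _ _]/xi_series linearZ /= [phi_fun _](pres_liftE phi_gen_rel) /= scalerA.
by rewrite mulrC mulrA mulVf ?dsym_neq0 // mul1r.
Qed.

Lemma phi_x_series e r :
  phi (x_series _ _ e tt r) = sqrtC d *: x_series B hbar e i r.
Proof.
case: r => [|r]; first by rewrite /= scaler0; exact: (rmorph0 phi).
rewrite [x_series _ _ _ _ _]/x_series linearZ /= [phi_fun _](pres_liftE phi_gen_rel) /= !scalerA.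
by congr (_ *: _); rewrite mulrC mulrA divfK ?dsym_neq0.
Qed.

End Phi.

Record rep (C : fieldType) (A : algType C) := Rep {
  rep_space :> vectType C;
  rep_act : {linear A -> 'End(rep_space)};
  rep_act1 : rep_act 1 = \1%VF;
  rep_actM : forall y z, rep_act (y * z) = (rep_act y \o rep_act z)%VF }.

Definition pullback (C : fieldType) (A A' : algType C)
    (f : {lrmorphism A -> A'}) (V : rep A') : rep A.
Proof.
refine (@Rep C A V (rep_act V \o f : {linear A -> 'End(V)}) _ _).
- by rewrite /= rmorph1 rep_act1.
- by move=> y z; rewrite /= rmorphM rep_actM.
Defined.

Section Representations.
Variables (C : fieldType) (A : algType C).
Implicit Types V W : rep A.

Definition subrep V (U : {vspace V}) : Prop :=
  forall y v, v \in U -> rep_act V y v \in U.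

Definition irreducible V : Prop :=
  (fullv : {vspace V}) != 0%VS /\
  forall U : {vspace V}, subrep U -> U = 0%VS \/ U = fullv.

Definition rep_iso V W : Prop :=
  exists f : 'Hom(V, W), [/\ lker f = 0%VS, limg f = fullv &
    forall y v, f (rep_act V y v) = rep_act W y (f v)].

(* W is isomorphic to U2 / U1: the restriction of f to U2 is a surjective
   intertwiner onto W with kernel U1 (every linear map on U2 is such a
   restriction). *)
Definition is_subquotient V (U1 U2 : {vspace V}) W : Prop :=
  exists f : 'Hom(V, W),
    [/\ (f @: U2)%VS = fullv, (U2 :&: lker f)%VS = U1 &
        forall y v, v \in U2 -> f (rep_act V y v) = rep_act W y (f v)].

(* W_0, ..., W_{N-1} are the simple factors F_{k+1} / F_k of a composition
   series 0 = F_0 <= F_1 <= ... <= F_N = V. *)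
Definition composition_factors V (N : nat) (W : 'I_N -> rep A) : Prop :=
  exists F : nat -> {vspace V},
    [/\ F 0%N = 0%VS, F N = fullv,
        forall k, (k <= N)%N -> subrep (F k) &
        forall k : 'I_N, [/\ (F k <= F k.+1)%VS, irreducible (W k) &
          is_subquotient (F k) (F k.+1) (W k)]].

End Representations.

(* sum_{r >= 0} X_r u^{-r} is the expansion at u = oo of the U-valued rational
   function (sum_k N_k u^k) / q(u), i.e. q(u) * sum_r X_r u^{-r} = N(u) in
   U((u^{-1})): the last two clauses compare the coefficients of u^k and of
   u^{-m-1}.  The former forces N k = 0 for k >= size q, so that N is indeed a
   polynomial. *)
Definition expansion (C : fieldType) (U : lmodType C)
    (X : nat -> U) (q : {poly C}) (N : nat -> U) : Prop :=
  [/\ q != 0,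
      forall k, \sum_(k <= j < size q) q`_j *: X (j - k)%N = N k &
      forall m, \sum_(j < size q) q`_j *: X (j + m.+1)%N = 0].

(* The rational function expanding to X has a pole at a: each way of writing
   it as N(u) / q(u) has q(a) = 0. *)
Definition is_pole (C : fieldType) (U : lmodType C) (X : nat -> U) (a : C) :
    Prop :=
  (exists q N, expansion X q N) /\ forall q N, expansion X q N -> root q a.

Section YangianRep.
Variables (C : numClosedFieldType) (I : finType) (B : I -> I -> C) (hbar : C).

Definition sigma (V : rep (Yangian B hbar)) (i : I) : set C :=
  [set a | is_pole (fun r => rep_act V (xi_series B hbar i r)) a \/
     exists e, is_pole (fun r => rep_act V (x_series B hbar e i r)) a]%classic.

End YangianRep.

Section DrinfeldPolynomial.
Variables (C : numClosedFieldType) (hbar : C).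
Local Notation Y := (Yangian_sl2 hbar).
Local Notation xi := (xi_series (@sl2_gram C) hbar tt).
Local Notation xp := (x_series (@sl2_gram C) hbar true tt).

Definition is_L (P : {poly C}) (L : rep Y) : Prop :=
  irreducible L /\
  exists Omega : L, [/\ Omega != 0,
    forall v, exists y, v = rep_act L y Omega,
    forall r, rep_act L (xp r) Omega = 0 &
    expansion (fun r => rep_act L (xi r) Omega)
      P (fun k => (P \Po ('X + hbar%:P))`_k *: Omega)].

Definition drinfeld_polynomial (P : {poly C}) (W : rep Y) : Prop :=
  P \is monic /\ exists L : rep Y, is_L P L /\ rep_iso W L.

End DrinfeldPolynomial.

Record lieAlgebra (K : fieldType) := LieAlgebra {
  lie_space :> vectType K;
  bracket : lie_space -> lie_space -> lie_space;
  bracket_linearl : forall z a x y,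
    bracket (a *: x + y) z = a *: bracket x z + bracket y z;
  bracket_linearr : forall z a x y,
    bracket z (a *: x + y) = a *: bracket z x + bracket z y;
  bracket_alt : forall x, bracket x x = 0;
  bracket_jacobi : forall x y z,
    bracket x (bracket y z) + bracket y (bracket z x)
      + bracket z (bracket x y) = 0 }.

Section Lie.
Variables (C : numClosedFieldType) (g : lieAlgebra C).
Local Notation br := (@bracket C g).

Definition simple_lie : Prop :=
  (exists x y : g, br x y != 0) /\
  forall U : {vspace g}, (forall x y, y \in U -> br x y \in U) ->
    U = 0%VS \/ U = fullv.

Definition cartan_subalgebra (h : {vspace g}) : Prop :=
  [/\ forall x y, x \in h -> y \in h -> br x y \in h,
      exists n, forall (s : n.-tuple g) y, {subset s <= h} -> y \in h ->
        foldr br y s = 0 &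
      forall x, (forall y, y \in h -> br x y \in h) -> x \in h].

Variable h : {vspace g}.
Local Notation dual := 'Hom(subvs_of h, C^o).

Definition is_root (b : dual) : Prop :=
  b != 0 /\
  exists2 x : g, x != 0 & forall t : subvs_of h, br (vsval t) x = b t *: x.

Definition simple_roots (I : finType) (alpha : I -> dual) : Prop :=
  [/\ forall i, is_root (alpha i),
      free (codom alpha) &
      forall b, is_root b -> exists n : I -> nat,
        b = \sum_i alpha i *+ n i \/ b = - (\sum_i alpha i *+ n i)].

Definition invariant_form (kappa : g -> g -> C) : Prop :=
  [/\ forall z a x y, kappa (a *: x + y) z = a * kappa x z + kappa y z,
      forall x y, kappa x y = kappa y x,
      forall x y z, kappa (br x y) z = kappa x (br y z) &
      forall x, (forall y, kappa x y = 0) -> x = 0].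

(* The element of h that represents b through kappa. *)
Definition dual_vec (kappa : g -> g -> C) (b : dual) : subvs_of h :=
  xget 0 [set t | forall s, kappa (vsval t) (vsval s) = b s]%classic.

Definition dual_form (kappa : g -> g -> C) (b c : dual) : C :=
  kappa (vsval (dual_vec kappa b)) (vsval (dual_vec kappa c)).

(* Short roots have squared length 2 (all roots are short in the simply
   laced case). *)
Definition normalized_form (kappa : g -> g -> C) : Prop :=
  [/\ invariant_form kappa,
      forall b, is_root b -> 2 <= dual_form kappa b b &
      exists2 b, is_root b & dual_form kappa b b = 2].

Definition gram (kappa : g -> g -> C) (I : finType) (alpha : I -> dual)
  (i j : I) : C := dual_form kappa (alpha i) (alpha j).

Lemma gram_neq0 kappa (I : finType) (alpha : I -> dual) :
  simple_roots alpha -> normalized_form kappa ->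
  forall i, gram kappa alpha i i != 0.
Proof.
move=> [ra _ _] [_ ge2 _] i; rewrite gt_eqF //.
by apply: lt_le_trans (ge2 _ (ra i)); rewrite ltr0n.
Qed.

End Lie.

(* Main.v *)
(* Writing the poles of a rational series in terms of the ideal of polynomials
   annihilating its coefficient sequence, sigma_i only sees the sl2-module
   phi_i^*(V), and everything rests on two facts about Y(sl2).

   Extensions create no poles.  Let a be a pole of x^+(u) on an extension V of
   W by U, but not a pole on U and W, and let y be the leading coefficient at
   a.  Then y maps V to U and kills U, and [y, x^-(v)] is a multiple of
   1 / (v - a) although it is regular at v = a; so y commutes with x^-_0 and
   has ad(xi_0)-weight 2, which forces y = 0 by sl2-theory on End(V).

   sigma(L(P)) = Z(P).  Matrix coefficients of a highest weight module depend
   polynomially on the roots of P, and for distinct roots there is an explicit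
   model on functions on the subsets of the set of roots.  Hence the relations
   P(u) x^+-(u) = polynomial, and xi(u) = P(u - hbar) / P(u) on (x^-_0)^m Omega,
   pass from the model to every L(P).  The first gives one inclusion.  For the
   other, climb from the bottom vector to Omega by leading coefficients of
   x^+(u) at poles b_1, b_2, ...: each step multiplies the eigenvalue of xi(u)
   by (u - b + hbar) / (u - b - hbar), so that Q(u - hbar) P(u + hbar) =
   Q(u + hbar) P(u - hbar) for Q the product of the u - b_j, whence Q and P
   have the same roots. *)
From HB Require Import structures.
Require Import Defs.
From mathcomp Require Import all_boot all_order all_algebra.
From mathcomp Require Import complex ring zify.
From mathcomp Require Import boolp classical_sets reals.

Set Implicit Arguments.
Unset Strict Implicit.
Unset Printing Implicit Defensive.

Import Order.TTheory GRing.Theory Num.Theory.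
Local Open Scope ring_scope.

(** * Poles as roots of annihilating polynomials *)

Section ShiftAction.
Variables (C : fieldType) (T : Type) (nx : T -> T).
Implicit Types (U W : lmodType C) (p q : {poly C}).

(** The polynomial [q] evaluated at the shift along [nx]. With [nx := S] it acts on coefficient
    sequences; with a shift of the integers it is multiplication by q(u) on Laurent series. *)
Definition shact U q (f : T -> U) (n : T) : U :=
  \sum_(j < size q) q`_j *: f (iter j nx n).

Lemma shact_widen U q (f : T -> U) n N : (size q <= N)%N ->
  shact q f n = \sum_(j < N) q`_j *: f (iter j nx n).
Proof.
move=> qN; rewrite /shact (big_ord_widen N (fun j => q`_j *: f (iter j nx n))) //.
rewrite big_mkcond; apply: eq_bigr => j _; case: ltnP => // /(nth_default 0) ->.
by rewrite scale0r.
Qed.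

Lemma eq_shact U q (f g : T -> U) : f =1 g -> shact q f =1 shact q g.
Proof. by move=> fg n; apply: eq_bigr => j _; rewrite fg. Qed.

Lemma shactD U p q (f : T -> U) n : shact (p + q) f n = shact p f n + shact q f n.
Proof.
set N := maxn (size p) (size q).
rewrite (@shact_widen _ (p + q) _ _ N) ?size_polyD //.
rewrite (@shact_widen _ p _ _ N) ?leq_maxl // (@shact_widen _ q _ _ N) ?leq_maxr //.
by rewrite -big_split; apply: eq_bigr => j _; rewrite coefD scalerDl.
Qed.

Lemma shactZ U a q (f : T -> U) n : shact (a *: q) f n = a *: shact q f n.
Proof.
rewrite (@shact_widen _ (a *: q) _ _ (size q)) ?size_scale_leq //.
by rewrite scaler_sumr; apply: eq_bigr => j _; rewrite coefZ scalerA.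
Qed.

Lemma shact0 U (f : T -> U) n : shact 0 f n = 0.
Proof. by rewrite /shact size_poly0 big_ord0. Qed.

Lemma shactC U a (f : T -> U) n : shact a%:P f n = a *: f n.
Proof.
by rewrite (@shact_widen _ a%:P _ _ 1%N) ?size_polyC ?leq_b1 // big_ord1 coefC.
Qed.

Lemma shactMX U q (f : T -> U) n : shact (q * 'X) f n = shact q f (nx n).
Proof.
rewrite (@shact_widen _ (q * 'X) _ _ (size q).+1); last first.
  by rewrite (leq_trans (size_polyMleq _ _)) // size_polyX addn2.
rewrite big_ord_recl coefMX eqxx scale0r add0r; apply: eq_bigr => j _.
by rewrite coefMX /= -iterSr.
Qed.

Lemma shactM U p q (f : T -> U) : shact (p * q) f =1 shact p (shact q f).
Proof.
elim/poly_ind: p => [|p c IHp] n; first by rewrite mul0r !shact0.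
rewrite mulrDl mulrAC !shactD !shactMX IHp; congr (_ + _).
by rewrite mul_polyC shactZ shactC.
Qed.

Lemma shact_XsubC U a (f : T -> U) n : shact ('X - a%:P) f n = f (nx n) - a *: f n.
Proof.
rewrite -['X]mul1r -[- _]scaleN1r shactD shactZ shactMX !shactC.
by rewrite scale1r scaleN1r.
Qed.

Lemma shact_linear U W (g : {linear U -> W}) q (f : T -> U) n :
  shact q (g \o f) n = g (shact q f n).
Proof. by rewrite linear_sum; apply: eq_bigr => j _; rewrite linearZ. Qed.

Lemma shactDr U q (f g : T -> U) n :
  shact q (fun k => f k + g k) n = shact q f n + shact q g n.
Proof. by rewrite -big_split; apply: eq_bigr => j _; rewrite scalerDr. Qed.

Lemma shact_sumr U (J : finType) (Q : pred J) q (f : J -> T -> U) n :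
  shact q (fun k => \sum_(i | Q i) f i k) n = \sum_(i | Q i) shact q (f i) n.
Proof. by rewrite exchange_big; apply: eq_bigr => j _; rewrite scaler_sumr. Qed.

Lemma shactZr U c q (f : T -> U) n : shact q (fun k => c *: f k) n = c *: shact q f n.
Proof. exact: (shact_linear ( *:%R c)). Qed.

Lemma shact_geom U q (f : T -> U) b n :
  (forall n, f (nx n) = b *: f n) -> shact q f n = q.[b] *: f n.
Proof.
move=> fb; rewrite horner_coef scaler_suml; apply: eq_bigr => j _.
rewrite -scalerA; congr (_ *: _).
elim: (j : nat) => [|k IHk]; first by rewrite scale1r.
by rewrite iterS fb IHk scalerA exprS.
Qed.

(** When [nx := S] and [f n] is the coefficient of u^(-n-1) in f(u), this says that q(u) f(u) is a
    polynomial. *)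
Definition ann U q (f : T -> U) : Prop := forall n, shact q f n = 0.

Lemma ann_mull U p q (f : T -> U) : ann q f -> ann (p * q) f.
Proof.
move=> qf n; rewrite shactM /shact big1 // => j _.
by have := qf (iter j nx n); rewrite /shact => ->; rewrite scaler0.
Qed.

Lemma ann_mulr U p q (f : T -> U) : ann q f -> ann (q * p) f.
Proof. by rewrite mulrC; apply: ann_mull. Qed.

Lemma ann_eq U q (f g : T -> U) : f =1 g -> ann q f -> ann q g.
Proof. by move=> fg qf n; rewrite -(eq_shact _ fg). Qed.

End ShiftAction.

Section Poles.
Variable C : closedFieldType.
Implicit Types (U W : lmodType C) (p q : {poly C}) (a b : C).
Local Notation act := (shact S).
Local Notation kills := (ann S).

Definition pole U (f : nat -> U) (a : C) : Prop :=
  (exists2 q, q != 0 & kills q f) /\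
  forall q, q != 0 -> kills q f -> root q a.

(** The numerator is determined by [q] and [X], so the only condition is that the negative powers of
    u cancel; they involve [X] from index 1 on. *)
Lemma expansionP U (X : nat -> U) q :
  (exists N, expansion X q N) <-> q != 0 /\ kills q (fun n => X n.+1).
Proof.
have E m : \sum_(j < size q) q`_j *: X (j + m.+1)%N = act q (fun n => X n.+1) m.
  by apply: eq_bigr => j _; rewrite iter_succn addnS addnC.
split=> [[N [q0 _ qX]]|[q0 qX]]; first by split=> // m; rewrite -E.
by eexists; split=> // m; rewrite E.
Qed.

Lemma is_poleE U (X : nat -> U) a : is_pole X a <-> pole (fun n => X n.+1) a.
Proof.
split=> [[[q [N qX]] Xa]|[[q q0 qX] Xa]]; split.
- by have [q0 kq] := (expansionP X q).1 (ex_intro _ N qX); exists q.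
- by move=> p p0 kp; have [M pX] := (expansionP X p).2 (conj p0 kp); apply: Xa pX.
- by exists q; apply/expansionP.
- by move=> p M /(ex_intro _ M)/expansionP [p0 kp]; apply: Xa.
Qed.

Lemma pole_sub U W (f : nat -> U) (g : nat -> W) a :
    (exists2 q, q != 0 & kills q f) -> (forall q, kills q f -> kills q g) ->
  pole g a -> pole f a.
Proof. by move=> rf fg [_ ga]; split=> // q q0 /fg; apply: ga. Qed.

Lemma eq_pole U W (f : nat -> U) (g : nat -> W) a :
  (forall q, kills q f <-> kills q g) -> pole f a <-> pole g a.
Proof.
by move=> fg; split=> [] [[q q0 qf] fa]; split=> [|p p0 /fg]; try exact: fa;
  exists q => //; apply/fg.
Qed.

Lemma pole_scale U (f : nat -> U) c a : c != 0 ->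
  pole (fun n => c *: f n) a <-> pole f a.
Proof.
move=> c0; apply: eq_pole => q; split=> qf n; move: (qf n); rewrite shactZr.
  by move/eqP; rewrite scaler_eq0 (negPf c0) => /eqP.
by move=> ->; rewrite scaler0.
Qed.

Lemma regularP U (f : nat -> U) a : (exists2 q, q != 0 & kills q f) ->
  ~ pole f a -> exists2 q, ~~ root q a & kills q f.
Proof.
move=> rf npole; apply: contrapT => nreg; apply: npole; split=> // q _ qf.
by apply: contrapT => /negP qa; apply: nreg; exists q.
Qed.

(* The series p(u) f(u) has polar part y / (u - a), a simple pole. *)
Definition geometric U (f : nat -> U) p a (y : U) : Prop :=
  forall n, act p f n = a ^+ n *: y.

Lemma geometric_root U (f : nat -> U) p a y q :
  geometric f p a y -> y != 0 -> kills q f -> root q a.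
Proof.
move=> fy y0 /(ann_mulr p)/(_ 0%N); rewrite shactM (shact_geom _ (b := a)).
  by rewrite fy scale1r => /eqP; rewrite scaler_eq0 (negPf y0) orbF.
by move=> n; rewrite !fy exprS scalerA.
Qed.

(** Take an annihilator q of least degree. If q = p (u - b), then p f is a geometric sequence of
    ratio b, nonzero since p has smaller degree. *)
Lemma ann_min U (f : nat -> U) : (exists2 q, q != 0 & kills q f) ->
  exists q, [/\ q != 0, kills q f &
    forall b, root q b -> exists p y, y != 0 /\ geometric f p b y].
Proof.
move=> [q0 q0n q0f].
have ex : exists n, `[< exists q, [/\ q != 0, kills q f & size q = n] >].
  by exists (size q0); apply/asboolP; exists q0.
case: (ex_minnP ex) => n /asboolP [q [qn qf sq]] minq.
exists q; split=> // b /factor_theorem [p qE].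
have gstep k : act p f k.+1 = b *: act p f k.
  apply/eqP; rewrite -subr_eq0 -shact_XsubC -shactM mulrC -qE.
  exact/eqP/qf.
have geo : geometric f p b (act p f 0).
  elim=> [|k IHk]; first by rewrite scale1r.
  by rewrite gstep IHk scalerA exprS.
exists p, (act p f 0); split=> //; apply/eqP => y0.
have pn : p != 0 by apply: contraNneq qn => p0; rewrite qE p0 mul0r.
have: (n <= size p)%N.
  by apply/minq/asboolP; exists p; split=> // k; rewrite geo y0 scaler0.
by rewrite -sq qE size_Mmonic ?monicXsubC // size_XsubC addn2 ltnn.
Qed.

Lemma pole_geometric U (f : nat -> U) a : pole f a ->
  exists p y, y != 0 /\ geometric f p a y.
Proof.
by move=> [rf fa]; have [q [q0 qf]] := ann_min rf; apply; apply: fa.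
Qed.

(** A minimal annihilator of a nonzero sequence is not constant, so it has a root in the closed
    field. *)
Lemma nonzero_geometric U (f : nat -> U) n : (exists2 q, q != 0 & kills q f) ->
  f n != 0 -> exists b p y, y != 0 /\ geometric f p b y.
Proof.
move=> rf fn; have [q [q0 qf qb]] := ann_min rf.
have [/eqP/size_poly1P [c c0 qc]|/closed_rootP [b /qb]] := eqVneq (size q) 1%N.
  by move/eqP: (qf n); rewrite qc shactC scaler_eq0 (negPf c0) (negPf fn).
by exists b.
Qed.

End Poles.

(** * Finite-dimensional linear algebra *)

Section FiniteDimensional.
Variable C : fieldType.
Local Notation act := (shact S).
Local Notation kills := (ann S).

(** The first dim M + 1 terms are linearly dependent, and applying [T] repeatedly carries this
    dependence to all later terms. *)
Lemma linear_recurrence_ann (M : vectType C) (T : M -> M) (f : nat -> M) :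
  linear T -> (forall n, f n.+1 = T (f n)) ->
  exists2 q : {poly C}, q != 0 & kills q f.
Proof.
move=> Tl fT; set d := dim M.
pose X := [tuple f i | i < d.+1].
have nfree : ~~ free X.
  apply/negP => /eqP; rewrite size_tuple => dX.
  by have := dimvS (subvf <<X>>); rewrite dX dimvf ltnn.
have [k [kX [i ki]]] : exists k : 'I_d.+1 -> C,
    \sum_i k i *: X`_i = 0 /\ exists i, k i <> 0.
  apply: contrapT => nex; case/negP: nfree; apply/freeP => k kX i.
  by apply: contrapT => ki; apply: nex; exists k; split=> //; exists i.
pose q := \poly_(j < d.+1) k (inord j).
have qj (j : 'I_d.+1) : q`_j = k j by rewrite coef_poly ltn_ord inord_val.
have q0f : act q f 0 = 0.
  rewrite (@shact_widen _ _ _ _ _ _ _ d.+1) ?size_poly // -[RHS]kX.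
  by apply: eq_bigr => j _; rewrite qj iter_succn_0 -tnth_nth tnth_mktuple.
exists q; first by apply/eqP => q0; apply: ki; rewrite -qj q0 coef0.
pose TT : {linear M -> M} := HB.pack T (GRing.isLinear.Build _ _ _ _ T Tl).
elim=> [//|n IHn]; rewrite -[RHS](linear0 TT) -IHn -(shact_linear S TT).
by apply: eq_bigr => j _; rewrite -iterSr /= fT.
Qed.

(** The recurrence is applied to the powers of [T] in End(M), so that one polynomial serves all
    vectors. *)
Lemma ann_iter (M : vectType C) (T : M -> M) : linear T ->
  exists2 q : {poly C}, q != 0 & forall v, act q (fun n => iter n T v) 0 = 0.
Proof.
move=> Tl; pose TT : {linear M -> M} := HB.pack T (GRing.isLinear.Build _ _ _ _ T Tl).
pose f n : 'End(M) := iter n (comp_lfun (linfun TT)) \1%VF.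
have compl : linear (comp_lfun (linfun TT) : 'End(M) -> 'End(M)).
  by move=> a g g'; rewrite comp_lfunDr comp_lfunZr.
have [q q0 qf] := @linear_recurrence_ann _ _ f compl (fun=> erefl).
exists q => // v; have := congr1 (fun g : 'End(M) => g v) (qf 0%N).
rewrite zero_lfunE sum_lfunE => <-; apply: eq_bigr => j _.
rewrite scale_lfunE iter_succn_0; congr (_ *: _).
elim: (j : nat) => [|k IHk]; first by rewrite id_lfunE.
by rewrite [RHS]comp_lfunE -IHk lfunE.
Qed.

(* Infinitely many eigenvalues would be roots of one annihilating polynomial. *)
Lemma eigenvalue_bound (M : vectType C) (T : M -> M) (mu : nat -> C) :
  linear T -> injective mu -> exists n, forall v, T v = mu n *: v -> v = 0.
Proof.
move=> Tl mu_inj; apply: contrapT => nex.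
have [q q0 qT] := ann_iter Tl.
have qmu n : root q (mu n).
  apply: contrapT => /negP qn; apply: nex; exists n => v Tv.
  pose TT : {linear M -> M} := HB.pack T (GRing.isLinear.Build _ _ _ _ T Tl).
  have := qT v; rewrite (shact_geom _ (b := mu n)) => [|k].
    by move/eqP; rewrite scaler_eq0 => /orP [/(negP qn)|/eqP].
  elim: k => [|k IHk]; first exact: Tv.
  by rewrite iterS IHk -[T _]/(TT _) linearZ; congr (_ *: _).
have := @max_poly_roots _ q (map mu (iota 0 (size q))) q0.
rewrite size_map size_iota ltnn map_inj_uniq // iota_uniq => /(_ _ isT).
by move=> H; have : false by apply: H; apply/allP => _ /mapP [n _ ->].
Qed.

(** A subspace of largest dimension inside [Q] contains every v in [Q], since otherwise adding the
    line of v would enlarge it. *)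
Lemma span_predicate (M : vectType C) (Q : M -> Prop) : Q 0 ->
  (forall a u v, Q u -> Q v -> Q (a *: u + v)) ->
  exists U : {vspace M}, forall v, v \in U <-> Q v.
Proof.
move=> Q0 QL.
have ex : exists n, `[< exists2 U : {vspace M}, \dim U = n & forall v, v \in U -> Q v >].
  exists 0%N; apply/asboolP; exists 0%VS; first by rewrite dimv0.
  by move=> v; rewrite memv0 => /eqP ->.
have bnd n : `[< exists2 U : {vspace M}, \dim U = n & forall v, v \in U -> Q v >] ->
    (n <= dim M)%N.
  by move=> /asboolP [U <- _]; rewrite -dimvf dimvS ?subvf.
case: (ex_maxnP ex bnd) => n /asboolP [U dU UQ] maxn.
exists U => v; split=> [/UQ //|Qv].
have /maxn : `[< exists2 U' : {vspace M}, \dim U' = \dim (U + <[v]>)%VS &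
    forall w, w \in U' -> Q w >].
  apply/asboolP; exists (U + <[v]>)%VS => // w /memv_addP [u uU [w' /vlineP [k ->] ->]].
  by rewrite addrC; apply: QL (UQ _ uU).
rewrite -dU => le; have /eqP -> : (U == U + <[v]>)%VS by rewrite eqEdim addvSl.
by rewrite (subvP (addvSr _ _)) // memv_line.
Qed.

End FiniteDimensional.

(** * Poles of extensions *)

Section Bracket.
Variables (C : fieldType) (A : algType C).
Implicit Types x y z : A.

Definition br x y : A := x * y - y * x.

Lemma brC x y : br x y = - br y x.
Proof. by rewrite opprB. Qed.

Fact br_linear x : linear (br x).
Proof.
move=> a y z; rewrite /br mulrDr mulrDl -scalerAl -scalerAr opprD addrACA.
by rewrite scalerBr.
Qed.

HB.instance Definition _ x := GRing.isLinear.Build C A A *:%R (br x) (br_linear x).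

Lemma brZl a x y : br (a *: x) y = a *: br x y.
Proof. by rewrite brC linearZ -scalerN -brC. Qed.

Lemma brBl x y z : br (x - y) z = br x z - br y z.
Proof. by rewrite /br mulrBr mulrBl !opprD !addrA; congr (_ + _); rewrite addrAC. Qed.

Lemma brMl x y z : br (x * y) z = x * br y z + br x z * y.
Proof. by rewrite /br mulrBr mulrBl !mulrA addrA subrK. Qed.

Lemma brNl x y : br (- x) y = - br x y.
Proof. by rewrite -scaleN1r brZl scaleN1r. Qed.

Lemma br_jacobi x y z : br x (br y z) = br (br x y) z + br y (br x z).
Proof.
have E (V : zmodType) (a b c d p q : V) :
    a - b - (c - d) = a - p - (q - d) + (p - c - (b - q)).
  rewrite !opprB !addrA [RHS](AC (8) ((1*8*3*6)*((5*2)*(7*4)))) /=.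
  by rewrite !subrr !addr0.
by rewrite /br !(mulrBr, mulrBl) !mulrA; exact: E.
Qed.

Lemma shact_br T nx q (f : T -> A) x n :
  shact nx q (fun k => br (f k) x) n = br (shact nx q f n) x.
Proof.
rewrite brC /shact linear_sum -sumrN; apply: eq_bigr => j _ /=.
by rewrite linearZ /= -scalerN -brC.
Qed.

End Bracket.

Lemma pmM (C : numClosedFieldType) e : pm C e * pm C e = 1.
Proof. by case: e; rewrite /pm ?mulrNN mulr1. Qed.

Lemma pm_neq0 (C : numClosedFieldType) e : pm C e != 0.
Proof. by case: e; rewrite /pm ?oppr_eq0 oner_eq0. Qed.

Definition sl2_relations (C : numClosedFieldType) (A : algType C) (hbar : C)
    (x : bool -> nat -> A) (xi : nat -> A) : Prop :=
  [/\ forall e s, br (xi 0%N) (x e s) = (pm C e * 2) *: x e s,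
      forall e r s, br (xi r.+1) (x e s) - br (xi r) (x e s.+1) =
        (pm C e * hbar) *: (xi r * x e s + x e s * xi r) &
      forall e r s, br (x e r) (x (~~ e) s) = pm C e *: xi (r + s)%N].

Section Subrepresentation.
Variables (C : fieldType) (A : algType C) (V : rep A) (U : {vspace V}).
Hypothesis subU : subrep U.

Let actU (y : A) (u : subvs_of U) : subvs_of U := vsproj U (rep_act V y (vsval u)).

Let actU_linear y : linear (actU y).
Proof. by move=> a u v; rewrite /actU !linearP. Qed.

Let actU_fun y : {linear subvs_of U -> subvs_of U} :=
  HB.pack (actU y) (GRing.isLinear.Build _ _ _ _ (actU y) (actU_linear y)).

Let rhoU (y : A) : 'End(subvs_of U) := linfun (actU_fun y).

Let rhoUE y u : vsval (rhoU y u) = rep_act V y (vsval u).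
Proof. by rewrite lfunE /= /actU vsprojK // subU // subvsP. Qed.

Let rhoU_linear : linear rhoU.
Proof.
move=> a y z; apply/lfunP => u; apply: val_inj; rewrite /= rhoUE linearP /=.
by rewrite !(add_lfunE, scale_lfunE) linearP /= !rhoUE.
Qed.

Definition sub_rep : rep A.
Proof.
apply: (@Rep C A (subvs_of U)
  (HB.pack rhoU (GRing.isLinear.Build _ _ _ _ rhoU rhoU_linear))) => [|y z];
  apply/lfunP => u; apply: val_inj; rewrite /= ?(comp_lfunE, rhoUE).
- by rewrite rep_act1 !id_lfunE.
- by rewrite rep_actM comp_lfunE.
Defined.

Lemma sub_repE y (u : sub_rep) :
  vsval (rep_act sub_rep y u : subvs_of U) = rep_act V y (vsval (u : subvs_of U)).
Proof. exact: rhoUE. Qed.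

End Subrepresentation.

Section Sl2.
Variables (C : numClosedFieldType) (hbar : C) (A : algType C).
Variables (x : bool -> nat -> A) (xi : nat -> A).
Hypothesis rel : sl2_relations hbar x xi.
Local Notation act := (shact S).
Local Notation kills := (ann S).
Implicit Types (U V W : rep A) (e : bool).

Let sl2_xi0_x e s : br (xi 0) (x e s) = (pm C e * 2) *: x e s.
Proof. by case: rel. Qed.

Let sl2_xi_x e r s : br (xi r.+1) (x e s) - br (xi r) (x e s.+1) =
  (pm C e * hbar) *: (xi r * x e s + x e s * xi r).
Proof. by case: rel. Qed.

Let sl2_x_x e r s : br (x e r) (x (~~ e) s) = pm C e *: xi (r + s)%N.
Proof. by case: rel. Qed.

(** The usual correction of xi_1 by a multiple of xi_0^2, chosen so that its adjoint action shifts
    the index of x^+ and x^-, up to the factor 2 or -2. *)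
Definition shift_elt : A := xi 1 - (hbar / 2) *: (xi 0 * xi 0).

Lemma br_shift_elt e s : br shift_elt (x e s) = (pm C e * 2) *: x e s.+1.
Proof.
have := sl2_xi_x e 0 s; rewrite sl2_xi0_x => /eqP; rewrite subr_eq => /eqP E.
rewrite brBl brZl brMl E sl2_xi0_x -scalerAl -scalerAr -scalerDr scalerA.
rewrite addrAC [_ / 2 * _](_ : _ = pm C e * hbar) ?subrr ?add0r //.
by rewrite mulrCA divfK // pnatr_eq0.
Qed.

Lemma sl2_xi0_act p e r : br (xi 0) (act p (x e) r) = (pm C e * 2) *: act p (x e) r.
Proof.
rewrite -(shact_linear _ (br (xi 0))) /shact scaler_sumr.
by apply: eq_bigr => j _; rewrite /= sl2_xi0_x !scalerA mulrC.
Qed.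

Lemma sl2_xi_act p e r s :
  br (xi r.+1) (act p (x e) s) - br (xi r) (act p (x e) s.+1) =
  (pm C e * hbar) *: (xi r * act p (x e) s + act p (x e) s * xi r).
Proof.
rewrite -(shact_linear S (br (xi r.+1))) -(shact_linear S (br (xi r))) /shact.
rewrite -sumrB mulr_sumr mulr_suml -big_split scaler_sumr.
apply: eq_bigr => j _; rewrite -scalerBr -iterSr /= sl2_xi_x.
by rewrite -scalerAr -scalerAl -scalerDr !scalerA mulrC.
Qed.

Section Action.
Variable V : rep A.
Local Notation rho := (rep_act V).

Lemma rhoM y z v : rho (y * z) v = rho y (rho z v).
Proof. by rewrite rep_actM comp_lfunE. Qed.

Lemma rhoD y z v : rho (y + z) v = rho y v + rho z v.
Proof. by rewrite linearD add_lfunE. Qed.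

Lemma rhoB y z v : rho (y - z) v = rho y v - rho z v.
Proof. by rewrite linearB add_lfunE opp_lfunE. Qed.

Lemma rhoZ c y v : rho (c *: y) v = c *: rho y v.
Proof. by rewrite linearZ scale_lfunE. Qed.

Lemma rho_br y z v : rho (br y z) v = rho y (rho z v) - rho z (rho y v).
Proof. by rewrite rhoB !rhoM. Qed.

Lemma rho_br0 y z : rho z = 0 -> rho (br y z) = 0.
Proof. by move=> z0; apply/lfunP => v; rewrite rho_br z0 !zero_lfunE linear0 subr0. Qed.

(** The sequence is the orbit of x_0 under a multiple of the commutator with [shift_elt], so it
    obeys a linear recurrence in the finite-dimensional space End(V). *)
Lemma x_rational e : exists2 q : {poly C}, q != 0 & kills q (rho \o (x e)).
Proof.
pose c := (pm C e * 2)^-1.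
have c0 : pm C e * 2 != 0.
  by rewrite mulf_neq0 ?pnatr_eq0 ?pm_neq0.
pose T (g : 'End(V)) : 'End(V) :=
  c *: ((rho shift_elt \o g) - (g \o rho shift_elt))%VF.
apply: (@linear_recurrence_ann _ _ T) => [a g g'|n].
  rewrite /T comp_lfunDr comp_lfunDl -comp_lfunZr -comp_lfunZl opprD addrACA.
  by rewrite -scalerBr scalerDr !scalerA mulrC.
rewrite /T /= -!rep_actM -linearB /= [_ - _]br_shift_elt linearZ scalerA.
by rewrite mulVf // scale1r.
Qed.

Lemma shact_xi_br p e r s :
  br (act p (x e) r) (x (~~ e) s) = pm C e *: act p xi (r + s)%N.
Proof.
rewrite -shact_br /shact scaler_sumr; apply: eq_bigr => j _.
by rewrite sl2_x_x !iter_succn addnAC scalerA mulrC -scalerA.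
Qed.

(** Every xi_n is, up to sign, the commutator of x_n with the x_0 of opposite sign. Hence the poles
    of xi(u) are among those of x^+(u) and among those of x^-(u). *)
Lemma kills_x_xi p e :
  kills p (rho \o (x e)) -> kills p (rho \o xi).
Proof.
move=> pe n; rewrite shact_linear -[n]addn0.
have -> : act p xi (n + 0) =
    pm C e *: br (act p (x e) n) (x (~~ e) 0).
  by rewrite shact_xi_br scalerA pmM scale1r.
rewrite brC linearZ /= linearN /= rho_br0 ?oppr0 ?scaler0 //.
by rewrite -shact_linear.
Qed.

(* In the adjoint sl2-module End(V), a vector killed by F of weight 2 vanishes:
   otherwise the E^k y would be eigenvectors of H for all the weights 2k + 2. *)
Lemma commuting_weight2 e y : br (xi 0) y = (pm C e * 2) *: y ->
  rho (br (x (~~ e) 0) y) = 0 -> rho y = 0.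
Proof.
move=> Hy Fy; set E := x e 0; set F := x (~~ e) 0; set H := xi 0.
pose z k := iter k (br E) y.
have Hz k : br H (z k) = (pm C e * (2 + 2 * k%:R)) *: z k.
  elim: k => [|k IHk]; first by rewrite mulr0 addr0.
  rewrite [z _]/= br_jacobi IHk linearZ /= sl2_xi0_x brZl -scalerDl; congr (_ *: _).
  by ring.
have FE k : rho (br F (z k.+1)) =
    (- (2 + 2 * k%:R)) *: rho (z k) + rho (br E (br F (z k))).
  rewrite [z k.+1]/= br_jacobi linearD /=; congr (_ + _).
  have -> : br F E = - (pm C e *: H) by rewrite brC sl2_x_x addn0.
  by rewrite brNl brZl Hz scalerA mulrA pmM mul1r linearN linearZ scaleNr.
(* The constant is the sum of the weights 2 + 2j for j up to k. It is never zero, so the vanishing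
   of some E^n y descends to y. *)
have Fz k : rho (br F (z k.+1)) = (- (k.+1%:R * k.+2%:R)) *: rho (z k).
  elim: k => [|k IHk]; first by rewrite FE rho_br0 // addr0 mulr0 addr0 mul1r.
  have -> : rho (br F (z k.+2)) = (- (2 + 2 * k.+1%:R)) *: rho (z k.+1) +
     (- (k.+1%:R * k.+2%:R)) *: rho (z k.+1).
    rewrite FE; congr (_ + _); apply/lfunP => v.
    rewrite (rho_br E) IHk (_ : z k.+1 = br E (z k)) // !scale_lfunE (rho_br E).
    by rewrite linearZ /= -scalerBr.
  by rewrite -scalerDl; congr (_ *: _); ring.
have [||n zn0] := @eigenvalue_bound _ 'End(V) (fun g => ((rho H \o g) - (g \o rho H))%VF)
    (fun k => pm C e * (2 + 2 * k%:R)).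
- move=> a g g'; rewrite comp_lfunDr comp_lfunDl -comp_lfunZr -comp_lfunZl.
  by rewrite opprD addrACA -scalerBr.
- move=> j k /mulfI; rewrite pm_neq0 => /(_ isT) /addrI /mulfI.
  by rewrite pnatr_eq0 => /(_ isT) /eqP; rewrite eqr_nat => /eqP.
have {}zn0 : rho (z n) = 0.
  by apply: zn0; rewrite -!rep_actM -linearB /= [_ - _]Hz linearZ.
elim: n zn0 => [//|n IHn] zn0; apply: IHn; apply/eqP.
have := Fz n; rewrite rho_br0 // => /esym/eqP.
by rewrite scaler_eq0 oppr_eq0 mulf_eq0 !pnatr_eq0.
Qed.

End Action.

(** Only x^+ and x^- enter, because by [kills_x_xi] every pole of xi(u) is a pole of both. *)
Definition regular V (a : C) : Prop :=
  forall e, exists2 q, ~~ root q a & kills q (rep_act V \o x e).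

Lemma regularNP V a : ~ regular V a <->
  pole (rep_act V \o xi) a \/ exists e, pole (rep_act V \o x e) a.
Proof.
have toX e : pole (rep_act V \o xi) a -> pole (rep_act V \o x e) a.
  by apply: pole_sub (x_rational V e) _ => q; apply: kills_x_xi.
split=> [nreg|[/(toX true) p|[e p]] reg].
- right; apply: contrapT => np; apply: nreg => e.
  by apply: (regularP (x_rational V e)) => pe; apply: np; exists e.
- have [q qa qx] := reg true; suff: root q a by rewrite (negPf qa).
  by apply: p.2 => //; apply: contraNneq qa => ->; rewrite root0.
- have [q qa qx] := reg e; suff: root q a by rewrite (negPf qa).
  by apply: p.2 => //; apply: contraNneq qa => ->; rewrite root0.
Qed.

Lemma regular_extension U V W (i : U -> V) (f : V -> W) a :
    injective i -> i 0 = 0 -> (forall y u, i (rep_act U y u) = rep_act V y (i u)) ->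
    (forall w, exists v, w = f v) -> (forall y v, f (rep_act V y v) = rep_act W y (f v)) ->
    (forall v, f v = 0 -> exists u, v = i u) ->
  regular U a -> regular W a -> regular V a.
Proof.
move=> i_inj i0 iM f_surj fM ker_f regU regW e.
apply: (regularP (x_rational V e)) => /pole_geometric [p [y [y0 py]]].
(* [Y] lifts the leading coefficient [y] at a to the algebra, so that it acts on U and W as well. *)
set Y := act p (x e) 0.
have Yy : rep_act V Y = y by have := py 0%N; rewrite shact_linear scale1r.
have Vn n : rep_act V (act p (x e) n) = a ^+ n *: rep_act V Y.
  by rewrite -shact_linear py Yy.
(* On U the action of [Y] is again a leading coefficient at a, which regularity forces to vanish;
   the same argument applies to W. *)
have killU u : rep_act U Y u = 0.
  have geo : geometric (rep_act U \o x e) p a (rep_act U Y).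
    move=> n; rewrite shact_linear; apply/lfunP => v; apply: i_inj.
    by rewrite scale_lfunE -[_ *: _]scale_lfunE -linearZ !iM /= linearZ Vn.
  have [q qa qx] := regU e; apply: contraNeq qa => Yu.
  apply: geometric_root geo _ qx; apply: contraNneq Yu => ->.
  by rewrite zero_lfunE.
have killW w : rep_act W Y w = 0.
  have geo : geometric (rep_act W \o x e) p a (rep_act W Y).
    move=> n; rewrite shact_linear; apply/lfunP => v; have [v' ->] := f_surj v.
    by rewrite -linearZ /= -!fM linearZ Vn.
  have [q qa qx] := regW e; apply: contraNeq qa => Yu.
  apply: geometric_root geo _ qx; apply: contraNneq Yu => ->.
  by rewrite zero_lfunE.
have f0 v : rep_act W 0 (f v) = 0 by rewrite linear0 zero_lfunE.
have fV0 : f 0 = 0 by rewrite -[X in f X](linear0 (rep_act V Y)) fM killW.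
pose z := rep_act V (act p xi 0).
(* The bracket with the x_0 of opposite sign transfers the simple polar part from x to xi. *)
have geo_z n : rep_act V (act p xi n) = a ^+ n *: z.
  have E r : act p xi r = pm C e *: br (act p (x e) r) (x (~~ e) 0).
    by rewrite shact_xi_br addn0 scalerA pmM scale1r.
  rewrite /z !E.
  rewrite !linearZ /=; congr (_ *: _).
  apply/lfunP => v; rewrite scale_lfunE !rho_br Vn !scale_lfunE.
  by rewrite linearZ scalerBr.
have YX s : rep_act V (br Y (x (~~ e) s)) = (pm C e * a ^+ s) *: z.
  by rewrite shact_xi_br add0n linearZ /= geo_z scalerA.
have [q1 q1a q1x] := regU (~~ e); have [q2 q2a q2x] := regW (~~ e).
(* [q1] and [q2] clear the opposite series on U and on W without vanishing at a. So [Q], like [Y],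
   maps V into U and kills U. *)
pose Q := act (q1 * q2) (x (~~ e)) 0.
have QU u : rep_act U Q u = 0.
  have := ann_mulr q2 q1x 0%N; rewrite shact_linear => /(congr1 (fun g : 'End(U) => g u)).
  by rewrite zero_lfunE.
have QW w : rep_act W Q w = 0.
  have := ann_mull q1 q2x 0%N; rewrite shact_linear => /(congr1 (fun g : 'End(W) => g w)).
  by rewrite zero_lfunE.
(* [Y] and [Q] therefore commute on V, whereas their bracket is (q1 q2)(a) z up to sign. *)
have z0 : z = 0.
  have : rep_act V (br Y Q) = 0.
    apply/lfunP => v; rewrite rho_br zero_lfunE.
    have [u ->] : exists u, rep_act V Q v = i u by apply: ker_f; rewrite fM QW.
    have [u' ->] : exists u, rep_act V Y v = i u by apply: ker_f; rewrite fM killW.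
    by rewrite -!iM killU QU i0 subr0.
  have -> : rep_act V (br Y Q) = (pm C e * (q1 * q2).[a]) *: z.
    rewrite -(shact_linear _ (br Y)) -shact_linear.
    transitivity (act (q1 * q2) (fun s => (pm C e * a ^+ s) *: z) 0).
      by apply: eq_shact => s; exact: YX.
    rewrite (shact_geom _ (b := a)) => [|n]; last by rewrite scalerA exprS mulrCA.
    by rewrite expr0 mulr1 scalerA mulrC.
  move=> /eqP; rewrite scaler_eq0 !mulf_eq0 (negPf (pm_neq0 _ _)) hornerM mulf_eq0.
  by rewrite (negPf (q1a : q1.[a] != 0)) (negPf (q2a : q2.[a] != 0)) => /eqP.
case/eqP: y0; rewrite -Yy; apply: (commuting_weight2 (e := e)).
- exact: sl2_xi0_act.
- by rewrite brC linearN /= YX z0 scaler0 oppr0.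
Qed.

(** An annihilator on V descends to every subquotient. Conversely, the F_k become regular one after
    the other by [regular_extension]. *)
Lemma regular_filtration V a N (W : 'I_N -> rep A) (F : nat -> {vspace V}) :
    F 0%N = 0%VS -> F N = fullv -> (forall k, (k <= N)%N -> subrep (F k)) ->
    (forall k : 'I_N, (F k <= F k.+1)%VS /\ is_subquotient (F k) (F k.+1) (W k)) ->
  regular V a <-> forall k, regular (W k) a.
Proof.
move=> F0 FN subF subqF; split=> [regV k e|regW].
  have [_ [f [fsurj _ fM]]] := subqF k; have [q qa qx] := regV e; exists q => // n.
  rewrite shact_linear; apply/lfunP => w; rewrite zero_lfunE.
  have /memv_imgP [v vF ->] : w \in (f @: F k.+1)%VS by rewrite fsurj memvf.
  rewrite -fM // -(shact_linear S (rep_act V)) qx zero_lfunE linear0 //.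
suff regF k (kN : (k <= N)%N) (subFk : subrep (F k)) : regular (sub_rep subFk) a.
  move=> e; have [q qa qx] := regF N (leqnn _) (subF N (leqnn _)) e.
  exists q => // n; apply/lfunP => v.
  have vF : v \in F N by rewrite FN memvf.
  have E : vsval (rep_act (sub_rep (subF N (leqnn _))) (act q (x e) n)
      (vsproj (F N) v) : subvs_of _) = 0.
    by rewrite -(shact_linear S (rep_act _)) qx zero_lfunE linear0.
  by rewrite shact_linear zero_lfunE -[v in LHS](vsprojK vF) -(@sub_repE _ _ _ _ (subF N (leqnn N))) E.
elim: k kN subFk => [|k IHk] kN subFk.
  move=> e; exists 1; first by rewrite root1.
  move=> n; apply/lfunP => u; apply: val_inj => /=; rewrite zero_lfunE linear0.
  by apply/eqP; rewrite -memv0 -F0 subvsP.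
have [FkS [f [fsurj kerf fM]]] := subqF (Ordinal kN).
have subFk' := subF k (ltnW kN).
have iK (u : subvs_of (F k)) : vsval (vsproj (F k.+1) (vsval u)) = vsval u.
  by rewrite vsprojK // (subvP FkS) // subvsP.
apply: (@regular_extension (sub_rep subFk') (sub_rep subFk) (W (Ordinal kN))
  (fun u => vsproj (F k.+1) (vsval (u : subvs_of (F k))))
  (fun v => f (vsval (v : subvs_of (F k.+1))))).
- by move=> u v /(congr1 vsval); rewrite [LHS]iK [RHS]iK => /val_inj.
- by rewrite !linear0.
- by move=> y u; apply: val_inj; rewrite [LHS]iK [LHS]sub_repE [RHS]sub_repE iK.
- move=> w; have /memv_imgP [v vF ->] : w \in (f @: F k.+1)%VS by rewrite fsurj memvf.
  by exists (vsproj (F k.+1) v); rewrite vsprojK.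
- by move=> y v; rewrite sub_repE fM // subvsP.
- move=> v fv0; exists (vsproj (F k) (vsval (v : subvs_of _))); apply: val_inj.
  rewrite [RHS]iK vsprojK //; move: kerf => /= <-.
  by rewrite memv_cap subvsP memv_ker fv0 eqxx.
- exact: IHk (ltnW kN) _.
- exact: regW.
Qed.

End Sl2.

Section Sl2Yangian.
Variables (C : numClosedFieldType) (hbar : C).
Hypothesis hbar_neq0 : hbar != 0.

Definition sl2_x e r := x_gen (@sl2_gram C) hbar e tt r.
Definition sl2_xi r := xi_gen (@sl2_gram C) hbar tt r.

Lemma Yangian_sl2_relations : sl2_relations hbar sl2_x sl2_xi.
Proof.
split=> [e s|e r s|e r s].
- by rewrite [LHS]xi0_x sl2_cartan sl2_dsym mul1r.
- by rewrite [LHS]xi_x /yang_coef sl2_cartan sl2_dsym mul1r mulfK // pnatr_eq0.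
- case: e; first by rewrite scale1r [LHS]xp_xm eqxx.
  by rewrite brC [X in - X]xp_xm eqxx addnC scaleN1r.
Qed.

Lemma sigma_sl2P (V : rep (Yangian_sl2 hbar)) a :
  sigma V tt a <-> ~ regular sl2_x V a.
Proof.
rewrite (regularNP Yangian_sl2_relations) /sigma /=.
have E g g' : (forall n, g' n.+1 = hbar *: g n) ->
    is_pole (rep_act V \o g') a <-> pole (rep_act V \o g) a.
  move=> gg; rewrite is_poleE -(pole_scale (rep_act V \o g) a hbar_neq0).
  by apply: eq_pole => q; split; apply: ann_eq => n; rewrite /= gg linearZ.
split=> [[|[e]]|[|[e]]].
- by move/(E sl2_xi) => p; left; apply: p.
- by move/(E (sl2_x e)) => p; right; exists e; apply: p.
- by move/(E sl2_xi (xi_series _ _ tt)) => p; left; apply: p.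
- by move/(E (sl2_x e) (x_series _ _ e tt)) => p; right; exists e; apply: p.
Qed.

End Sl2Yangian.

(** * Normal ordering in highest weight modules *)

Section NormalOrdering.
Variables (C : numClosedFieldType) (hbar : C).
Local Notation term := (aterm C (ygen unit)).
Local Notation X e r := (YX e tt r).
Local Notation Xi r := (YXi tt r).

(** Terms act here, rather than elements of the algebra, since [op] is an arbitrary family of
    maps. *)
Fixpoint tact (V : lmodType C) (op : ygen unit -> V -> V) (t : term) (v : V) : V :=
  match t with
  | AGen g => op g v
  | AScal a => a *: v
  | AAdd t u => tact op t v + tact op u v
  | AMul t u => tact op t (tact op u v)
  end.

(* Only the relations needed to move every x^-_r to the left are required, so
   the space need not be a module over the Yangian. *)
Record hw_module (lam : nat -> C) (V : lmodType C) (op : ygen unit -> V -> V)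
    (Om : V) : Prop := HwModule {
  hw_linear : forall g, linear (op g);
  hw_xp_xm : forall r s v, op (X true r) (op (X false s) v) =
    op (X false s) (op (X true r) v) + op (Xi (r + s)) v;
  hw_xi0_xm : forall s v, op (Xi 0) (op (X false s) v) =
    op (X false s) (op (Xi 0) v) - 2 *: op (X false s) v;
  hw_xi_xm : forall r s v, op (Xi r.+1) (op (X false s) v) =
    op (X false s) (op (Xi r.+1) v) + op (Xi r) (op (X false s.+1) v)
    - op (X false s.+1) (op (Xi r) v)
    - hbar *: (op (Xi r) (op (X false s) v) + op (X false s) (op (Xi r) v));
  hw_xp : forall r, op (X true r) Om = 0;
  hw_xi : forall r, op (Xi r) Om = lam r *: Om }.

(** [phi] reads off the component along the highest weight vector; its values on translates of [Om]
    are the matrix coefficients to be compared. *)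
Record vacuum (V : lmodType C) (op : ygen unit -> V -> V) (Om : V) (phi : V -> C) :
    Prop := Vacuum {
  vac_linear : forall a u v, phi (a *: u + v) = a * phi u + phi v;
  vac_Om : phi Om = 1;
  vac_xm : forall r v, phi (op (X false r) v) = 0 }.

Definition xm_word (V : lmodType C) (op : ygen unit -> V -> V) (Om : V) (l : seq nat) : V :=
  foldr (fun r => op (X false r)) Om l.

Section Vacuum.
Variables (lam : nat -> C) (V : lmodType C) (op : ygen unit -> V -> V) (Om : V).
Variable phi : V -> C.
Hypotheses (hw : hw_module lam op Om) (vac : vacuum op Om phi).

Definition vac_fun : {linear V -> C^o} :=
  HB.pack (phi : V -> C^o) (GRing.isLinear.Build _ _ _ _ (phi : V -> C^o) (vac_linear vac)).

Lemma vacD u v : phi (u + v) = phi u + phi v.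
Proof. exact: (linearD vac_fun). Qed.

Lemma vacB u v : phi (u - v) = phi u - phi v.
Proof. exact: (linearB vac_fun). Qed.

Lemma vacZ c v : phi (c *: v) = c * phi v.
Proof. by rewrite -[phi _]/(vac_fun _) linearZ. Qed.

(** When xi_r is moved past x^-, each resulting term starts with x^- or has a smaller index of
    xi. *)
Lemma vac_xi_xm r s v : phi (op (Xi r) (op (X false s) v)) = 0.
Proof.
elim: r s v => [|r IHr] s v.
  by rewrite (hw_xi0_xm hw) vacB vacZ !(vac_xm vac) mulr0 subr0.
by rewrite (hw_xi_xm hw) !vacB vacZ !vacD !(vac_xm vac) !IHr !(addr0, mulr0, subr0).
Qed.

Lemma xm_word_weight l :
  op (Xi 0) (xm_word op Om l) = (lam 0%N - 2 * (size l)%:R) *: xm_word op Om l.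
Proof.
elim: l => [|r l IHl]; first by rewrite (hw_xi hw) mulr0 subr0.
have lop : linear (op (X false r)) := hw_linear hw _.
pose F : {linear V -> V} := HB.pack (op (X false r)) (GRing.isLinear.Build _ _ _ _ _ lop).
rewrite /= (hw_xi0_xm hw) IHl -[op _ (_ *: _)]/(F _) linearZ /= -scalerBl.
by congr (_ *: _); ring.
Qed.

(** The classical sl2 computation of e f^(k+1) on a highest weight vector, by induction from [e, f]
    = h. *)
Lemma xp_xm_power k : op (X true 0) (iter k.+1 (op (X false 0)) Om) =
  (k.+1%:R * (lam 0%N - k%:R)) *: iter k (op (X false 0)) Om.
Proof.
have lop : linear (op (X false 0)) := hw_linear hw _.
pose F : {linear V -> V} := HB.pack (op (X false 0)) (GRing.isLinear.Build _ _ _ _ _ lop).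
have wt j : op (Xi 0) (iter j (op (X false 0)) Om) =
    (lam 0%N - 2 * j%:R) *: iter j (op (X false 0)) Om.
  have := xm_word_weight (nseq j 0%N); rewrite size_nseq.
  by rewrite (_ : xm_word _ _ _ = iter j (op (X false 0)) Om) //; elim: j => //= j ->.
elim: k => [|k IHk].
  rewrite /= (hw_xp_xm hw) (hw_xp hw) -[op _ 0]/(F 0) linear0 add0r (hw_xi hw).
  by congr (_ *: _); ring.
rewrite [in LHS]iterS (hw_xp_xm hw) IHk wt -[op _ (_ *: _)]/(F _) linearZ /= -scalerDl.
by congr (_ *: _); ring.
Qed.

End Vacuum.

Variable lam : nat -> {poly C}.

(** A recipe for a vector in every module at once; the last argument is the parameter t on which the
    highest weight depends. *)
Definition vec_family : Type :=
  forall V : lmodType C, (ygen unit -> V -> V) -> V -> C -> V.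
Implicit Types (f g : vec_family) (s : seq ({poly C} * seq nat)).

Definition normal_form s : vec_family := fun V op Om t =>
  \sum_(c <- s) c.1.[t] *: xm_word op Om c.2.

(** The list [s] is chosen before t and the module, so that a single polynomial in t gives a matrix
    coefficient in all modules. *)
Definition normalizable f : Prop := exists s, forall t V op Om,
  @hw_module (fun r => (lam r).[t]) V op Om ->
  f V op Om t = normal_form s op Om t.

Lemma normalizable_eq f g : (forall t V op Om,
    @hw_module (fun r => (lam r).[t]) V op Om -> g V op Om t = f V op Om t) ->
  normalizable f -> normalizable g.
Proof.
move=> fg [s fs]; exists s => t V op Om sys.
by rewrite (fg t V op Om sys) (fs t V op Om sys).
Qed.

Lemma normalizable0 : normalizable (fun V op Om t => 0).
Proof. by exists [::] => *; rewrite /normal_form big_nil. Qed.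

Lemma normalizable_word (p : {poly C}) l :
  normalizable (fun V op Om t => p.[t] *: xm_word op Om l).
Proof. by exists [:: (p, l)] => *; rewrite /normal_form big_seq1. Qed.

Lemma normalizableD f g : normalizable f -> normalizable g ->
  normalizable (fun V op Om t => f V op Om t + g V op Om t).
Proof.
move=> [s fs] [s' gs']; exists (s ++ s') => t V op Om sys.
by rewrite (fs _ _ _ _ sys) (gs' _ _ _ _ sys) /normal_form big_cat.
Qed.

Lemma normalizableZ (p : {poly C}) f : normalizable f ->
  normalizable (fun V op Om t => p.[t] *: f V op Om t).
Proof.
move=> [s fs]; exists [seq (p * c.1, c.2) | c <- s] => t V op Om sys.
rewrite (fs _ _ _ _ sys) /normal_form big_map scaler_sumr.
by apply: eq_bigr => c _; rewrite hornerM scalerA.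
Qed.

Lemma normalizable_comp (T : forall V : lmodType C, (ygen unit -> V -> V) -> V -> V) f :
    (forall t V op Om, @hw_module (fun r => (lam r).[t]) V op Om ->
      linear (T V op)) ->
    (forall l, normalizable (fun V op Om t => T V op (xm_word op Om l))) ->
  normalizable f -> normalizable (fun V op Om t => T V op (f V op Om t)).
Proof.
move=> Tl Tw [s fs].
apply: (@normalizable_eq (fun V op Om t => T V op (normal_form s op Om t))).
  by move=> t V op Om sys; rewrite (fs _ _ _ _ sys).
elim: s {fs} => [|[p l] s IHs].
  apply: normalizable_eq normalizable0 => t V op Om sys.
  have Tlin := Tl t V op Om sys.
  pose TT : {linear V -> V} := HB.pack (T V op) (GRing.isLinear.Build _ _ _ _ (T V op) Tlin).
  by rewrite /normal_form big_nil -[LHS]/(TT 0) linear0.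
apply: normalizable_eq (normalizableD (normalizableZ p (Tw l)) IHs).
move=> t V op Om sys; have Tlin := Tl t V op Om sys.
by rewrite /normal_form big_cons Tlin.
Qed.

Lemma xm_word_normalizable r f : normalizable f ->
  normalizable (fun V op Om t => op (X false r) (f V op Om t)).
Proof.
apply: (@normalizable_comp (fun V op => op (X false r))).
  by move=> t V op Om sys; apply: hw_linear sys _.
move=> l; apply: normalizable_eq (normalizable_word 1 (r :: l)).
by move=> *; rewrite hornerC scale1r.
Qed.

(** Induction on the word, then on [r]. The relation for xi_(r+1) x^-_k produces xi_r x^-_(k+1), so
    the leading letter [k] has to vary in the inner induction. *)
Lemma xi_word_normalizable r l :
  normalizable (fun V op Om t => op (Xi r) (xm_word op Om l)).
Proof.
elim: l r => [|k l IHl] r.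
  apply: normalizable_eq (normalizable_word (lam r) [::]).
  by move=> t V op Om sys; rewrite /= (hw_xi sys).
elim: r k => [|r IHr] k.
  apply: normalizable_eq (normalizableD (xm_word_normalizable k (IHl 0%N))
    (normalizable_word (- 2)%:P (k :: l))).
  by move=> t V op Om sys; rewrite /= (hw_xi0_xm sys) hornerC scaleNr.
apply: normalizable_eq (normalizableD (normalizableD (normalizableD
  (xm_word_normalizable k (IHl r.+1)) (IHr k.+1))
  (normalizableZ (- 1)%:P (xm_word_normalizable k.+1 (IHl r))))
  (normalizableZ (- hbar)%:P (normalizableD (IHr k) (xm_word_normalizable k (IHl r))))).
by move=> t V op Om sys; rewrite /= (hw_xi_xm sys) !hornerC scaleN1r scaleNr.
Qed.

Lemma xp_word_normalizable r l :
  normalizable (fun V op Om t => op (X true r) (xm_word op Om l)).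
Proof.
elim: l => [|k l IHl].
  by apply: normalizable_eq normalizable0 => t V op Om sys; rewrite /= (hw_xp sys).
apply: normalizable_eq (normalizableD (xm_word_normalizable k IHl)
  (xi_word_normalizable (r + k) l)).
by move=> t V op Om sys; rewrite /= (hw_xp_xm sys).
Qed.

Lemma tact_linear (V : lmodType C) (op : ygen unit -> V -> V) :
  (forall x, linear (op x)) -> forall z, linear (tact op z).
Proof.
move=> opl; elim=> [x|a|t IHt u IHu|t IHt u IHu] c v w /=; first exact: opl.
- by rewrite scalerDr !scalerA mulrC.
- by rewrite IHt IHu scalerDr addrACA.
- by rewrite IHu IHt.
Qed.

Lemma tact_normalizable z f : normalizable f ->
  normalizable (fun V op Om t => tact op z (f V op Om t)).
Proof.
elim: z f => [[[] r|[] [] r]|a|z IHz y IHy|z IHz y IHy] f fn /=.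
- apply: (@normalizable_comp (fun V op => op (Xi r))) fn => [t V op Om sys|l].
    exact: hw_linear sys _.
  exact: xi_word_normalizable.
- apply: (@normalizable_comp (fun V op => op (X true r))) fn => [t V op Om sys|l].
    exact: hw_linear sys _.
  exact: xp_word_normalizable.
- exact: xm_word_normalizable.
- by apply: normalizable_eq (normalizableZ a%:P fn) => *; rewrite hornerC.
- exact: normalizableD (IHz _ fn) (IHy _ fn).
- exact: IHz (IHy _ fn).
Qed.

Lemma vacuum_polynomial z : exists p : {poly C}, forall t V op phi Om,
  @hw_module (fun r => (lam r).[t]) V op Om -> vacuum op Om phi ->
  phi (tact op z Om) = p.[t].
Proof.
have [s zs] := tact_normalizable z (normalizable_word 1 [::]).
(* [phi] annihilates every word that starts with x^-, so only the empty word contributes. *)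
exists (\sum_(c <- s | c.2 == [::]) c.1) => t V op phi Om sys vac.
have := zs t V op Om sys; rewrite /= hornerC scale1r => ->.
pose phi' : V -> C^o := phi.
pose F : {linear V -> C^o} := HB.pack phi' (GRing.isLinear.Build _ _ _ _ phi' (vac_linear vac)).
rewrite -[phi _]/(F _) /normal_form linear_sum horner_sum [RHS]big_mkcond.
apply: eq_bigr => -[p [|r l]] _; rewrite linearZ.
  by rewrite [F _](vac_Om vac) [RHS]/= -[LHS]/(_ * _) mulr1.
by rewrite [F _](vac_xm vac); exact: mulr0.
Qed.

Lemma tact_span z : exists s, forall t V op Om,
  @hw_module (fun r => (lam r).[t]) V op Om ->
  tact op z Om = normal_form s op Om t.
Proof.
have [s zs] := tact_normalizable z (normalizable_word 1 [::]).
exists s => t V op Om sys.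
by rewrite -(zs t V op Om sys) /= hornerC scale1r.
Qed.

End NormalOrdering.

(** * Laurent series at infinity and highest weights *)

Section LaurentSeries.
Variable C : fieldType.
Implicit Types (U : lmodType C) (p q : {poly C}) (n : int).

(* A function on int stands for the Laurent series in u^-1 whose coefficient
   of u^-n is its value at n; multiplication by u is then a shift. *)
Definition nxz n : int := n + 1.
Local Notation lact := (shact nxz).

Definition of_series U (f : nat -> U) n : U := if n is Posz k then f k else 0.

(** The coefficient of u^k sits at the index -k, and [Negz k] is -(k+1). *)
Definition of_poly U (f : nat -> U) n : U :=
  match n with Posz 0 => f 0%N | Posz _ => 0 | Negz k => f k.+1 end.

Definition lpoly p : int -> C^o := of_poly (fun k => p`_k : C^o).

Lemma lpolyD p q n : lpoly (p + q) n = lpoly p n + lpoly q n.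
Proof. by case: n => [[|k]|k]; rewrite /= ?addr0 // coefD. Qed.

Lemma lpolyZ c p n : lpoly (c *: p) n = c *: lpoly p n.
Proof. by case: n => [[|k]|k]; rewrite /= ?scaler0 // coefZ. Qed.

Lemma lpolyMX p n : lpoly (p * 'X) n = lpoly p (nxz n).
Proof.
case: n => [[|k]|[|k]].
- by rewrite /= coefMX eqxx.
- by rewrite /nxz -PoszD addn1.
- by rewrite /= coefMX.
- rewrite (_ : nxz (Negz k.+1) = Negz k) /= ?coefMX //.
  by rewrite /nxz !NegzE -[k.+2]addn1 PoszD opprD addrNK.
Qed.

Lemma lact_lpoly q p n : lact q (lpoly p) n = lpoly (q * p) n.
Proof.
elim/poly_ind: q n => [|q c IHq] n.
  by rewrite shact0 mul0r; case: n => [[|k]|k]; rewrite /= ?coef0.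
rewrite mulrDl mulrAC mul_polyC shactD shactMX shactC IHq.
by rewrite lpolyD lpolyMX lpolyZ.
Qed.

Lemma lpoly_inj p q : lpoly p =1 lpoly q -> p = q.
Proof.
by move=> pq; apply/polyP => -[|k]; [apply: (pq 0)|apply: (pq (Negz k))].
Qed.

(** A series killed by u - b satisfies F(n+1) = b F(n), so the zeros below [n0] propagate
    upwards. *)
Lemma lact_XsubC_inj U b (F : int -> U) n0 : (forall n, (n < n0)%R -> F n = 0) ->
  lact ('X - b%:P) F =1 (fun=> 0) -> F =1 (fun=> 0).
Proof.
move=> Fn0 bF n.
have Fk (k : nat) : F (n0 + k%:Z - 1) = 0.
  elim: k => [|k IHk].
    by apply: Fn0; rewrite addr0 ltrBlDr ltzD1.
  have /eqP := bF (n0 + k%:Z - 1); rewrite shact_XsubC IHk scaler0 subr0.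
  by rewrite /nxz subrK -addn1 PoszD addrA addrK => /eqP.
have [nn0|n0n] := ltP n n0; first exact: Fn0.
have := Fk (absz (n - n0 + 1)); rewrite gez0_abs; last by apply: addr_ge0; rewrite ?subr_ge0.
by rewrite addrA addrK addrC subrK.
Qed.

Lemma lact_inj U (rs : seq C) (F : int -> U) n0 :
    (forall n, (n < n0)%R -> F n = 0) ->
  lact (\prod_(a <- rs) ('X - a%:P)) F =1 (fun=> 0) -> F =1 (fun=> 0).
Proof.
elim: rs F n0 => [|a rs IHrs] F n0 Fn0 sF n.
  by have := sF n; rewrite big_nil shactC scale1r.
rewrite (lact_XsubC_inj (n0 := n0) (b := a)) // => {}n.
apply: (IHrs _ (n0 - 1)) => [{}n nn0|{}n].
  rewrite shact_XsubC !Fn0 ?scaler0 ?subr0 //; last by rewrite /nxz -ltrBrDr.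
  by rewrite (lt_trans nn0) // gtrBl.
by have := sF n; rewrite big_cons mulrC shactM.
Qed.

End LaurentSeries.

Section HighestWeightSeries.
(* The expansion at infinity of the product of the 1 + h / (u - b). *)
Fixpoint weight_series (R : comNzRingType) (h : R) (bs : seq R) (n : nat) : R :=
  if bs is b :: bs' then
    weight_series h bs' n +
      h * \sum_(k < n) b ^+ (n.-1 - k) * weight_series h bs' k
  else (n == 0%N)%:R.

Lemma weight_series0 (R : comNzRingType) (h : R) bs : weight_series h bs 0 = 1.
Proof. by elim: bs => [//|b bs IHbs] /=; rewrite big_ord0 mulr0 addr0. Qed.

Lemma weight_series_morph (R S : comNzRingType) (f : {rmorphism R -> S}) h bs n :
  f (weight_series h bs n) = weight_series (f h) (map f bs) n.
Proof.
elim: bs n => [|b bs IHbs] n /=; first by rewrite rmorph_nat.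
rewrite rmorphD rmorphM rmorph_sum IHbs; congr (_ + _ * _).
by apply: eq_bigr => k _; rewrite rmorphM rmorphXn IHbs.
Qed.

(** One step of the recursion multiplies by 1 + h/(u - b), and (u - b)(1 + h/(u - b)) = u - (b -
    h). *)
Lemma weight_seriesP (C : fieldType) (h : C) bs n :
  shact nxz (\prod_(b <- bs) ('X - b%:P)) (of_series (weight_series h bs : nat -> C^o)) n
  = lpoly (\prod_(b <- bs) ('X - (b - h)%:P)) n.
Proof.
elim: bs n => [|b bs IHbs] n.
  rewrite !big_nil shactC scale1r.
  by case: n => [[|n]|n] //=; rewrite coef1.
rewrite !big_cons mulrC shactM.
rewrite (@eq_shact _ _ _ _ _ _
  (shact nxz ('X - (b - h)%:P) (of_series (weight_series h bs : nat -> C^o)))); last first.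
  move=> {}n; rewrite !shact_XsubC.
  case: n => [n|[|n]].
  - rewrite /nxz -PoszD addn1 /= big_ord_recr /= subnn mul1r.
    under [X in h * (X + _)]eq_bigr => k _.
      rewrite (_ : (n - k = (n.-1 - k).+1)%N) ?exprS -?mulrA; last first.
        by rewrite -subSn ?prednK // ?(leq_ltn_trans _ (ltn_ord k)) // -ltnS prednK ?(leq_ltn_trans _ (ltn_ord k)).
      over.
    rewrite -mulr_sumr -[_ *: (_ + _)]/(_ * (_ + _)) -[_ *: _]/(_ * _); ring.
  - by rewrite /nxz /= big_ord0 mulr0 addr0 !scaler0 !subr0.
  - rewrite (_ : nxz (Negz n.+1) = Negz n) /= ?scaler0 //.
    by rewrite /nxz !NegzE -[n.+2]addn1 PoszD opprD addrNK.
rewrite -shactM mulrC shactM.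
by rewrite (eq_shact nxz _ IHbs) lact_lpoly.
Qed.

End HighestWeightSeries.

(** * Highest weight modules with distinct roots *)

(* The indicator function of S is an eigenvector of xi(u), with eigenvalue the
   product over the roots a_k of (u - a_k - hbar) / (u - a_k) for k in S and of
   (u - a_k + hbar) / (u - a_k) for k outside S. *)
Section SubsetModel.
Variables (C : numClosedFieldType) (hbar : C) (m : nat) (a : 'I_m -> C).
Hypothesis hbar_neq0 : hbar != 0.
Hypothesis a_inj : injective a.
Implicit Types (S : {set 'I_m}) (i j k : 'I_m).
Local Notation V := {ffun {set 'I_m} -> C^o}.

Let a_neq i j : i != j -> a i - a j != 0.
Proof. by rewrite subr_eq0 (inj_eq a_inj). Qed.

(** Up to a factor hbar or -hbar, the residue at a_i of the eigenvalue of xi(u) is a product over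
    the k in S times one over the k outside S, with k different from i. The first product goes into
    x^-, which adds i to S, the second ([model_up]) into x^+, which removes it. *)
Definition model_dn S i : C := \prod_(k in S) ((a i - a k - hbar) / (a i - a k)).
Definition model_up S i : C :=
  \prod_(k | k \notin S) ((a i - a k + hbar) / (a i - a k)).
Definition model_wt r S : C :=
  \sum_i (if i \in S then -1 else 1) * (model_dn (S :\ i) i * model_up (i |: S) i) * a i ^+ r.

Definition model_op (z : ygen unit) (f : V) : V :=
  match z with
  | YXi _ r => [ffun S : {set 'I_m} => model_wt r S * f S]
  | YX false _ r => [ffun S : {set 'I_m} => \sum_(i in S) a i ^+ r * model_dn (S :\ i) i * f (S :\ i)]
  | YX true _ r =>
    [ffun S : {set 'I_m} => \sum_(i | i \notin S) a i ^+ r * model_up (i |: S) i * f (i |: S)]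
  end.

Lemma model_op_linear z : linear (model_op z).
Proof.
have E (c u v w : C) : w * (c * u + v) = c * (w * u) + w * v by ring.
move=> c f g; case: z => [u r|[] u r]; apply/ffunP => S; rewrite !ffunE.
- exact: E.
- rewrite scaler_sumr -big_split; apply: eq_bigr => i _.
  by rewrite !ffunE; exact: E.
- rewrite scaler_sumr -big_split; apply: eq_bigr => i _.
  by rewrite !ffunE; exact: E.
Qed.

(** The factor (a_i - a_j + hbar)/(a_i - a_j) is unchanged when i and j are exchanged and hbar
    changes sign. This makes [x^+, x^-] diagonal. *)
Lemma model_up_dn S i j : i \notin S -> j \in S ->
  model_up (i |: S) i * model_dn (i |: (S :\ j)) j =
  model_dn (S :\ j) j * model_up (i |: (S :\ j)) i.
Proof.
move=> iS jS; have ij : i != j by apply: contraNneq iS => ->.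
have -> : model_up (i |: (S :\ j)) i =
    (a i - a j + hbar) / (a i - a j) * model_up (i |: S) i.
  rewrite /model_up (bigD1 j) /=; last by rewrite !inE eqxx orbF eq_sym.
  congr (_ * _); apply: eq_bigl => k; rewrite !inE !negb_or negb_and negbK.
  by case: (eqVneq k j) => [->|_] /=; rewrite ?jS ?andbF ?andbT.
have -> : model_dn (i |: (S :\ j)) j =
    (a j - a i - hbar) / (a j - a i) * model_dn (S :\ j) j.
  by rewrite /model_dn big_setU1 //= !inE negb_and iS orbT.
have -> : (a j - a i - hbar) / (a j - a i) = (a i - a j + hbar) / (a i - a j).
  by rewrite -[a j - a i]opprB -opprD invrN mulrNN.
by rewrite mulrC mulrAC mulrC.
Qed.

Lemma model_xp_xm r s (v : V) :
  model_op (YX true tt r) (model_op (YX false tt s) v) =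
  model_op (YX false tt s) (model_op (YX true tt r) v) + model_op (YXi tt (r + s)) v.
Proof.
apply/ffunP => S; rewrite !ffunE.
(* [d] collects the terms in which the same element is added and removed, [o] the others, which
   cancel between the two orders. *)
pose d i : C := model_dn (S :\ i) i * model_up (i |: S) i * a i ^+ (r + s) * v S.
pose o i j : C := model_up (i |: S) i * model_dn (i |: (S :\ j)) j
  * (a i ^+ r * a j ^+ s) * v (i |: (S :\ j)).
transitivity (\sum_(i | i \notin S) (d i + \sum_(j in S) o i j)).
  apply: eq_bigr => i iS; rewrite ffunE big_setU1 // mulrDr mulr_sumr.
  congr (_ + _).
    have SE : S :\ i = S by apply/setP => k; rewrite !inE; case: eqVneq => // ->; rewrite (negPf iS).
    by rewrite /d SE setU1K // exprD; ring.
  apply: eq_bigr => j jS; rewrite /o.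
  have -> : (i |: S) :\ j = i |: (S :\ j).
    apply/setP => k; rewrite !inE; case: (eqVneq k i) => [->|//].
    by rewrite andbT; apply: contraNneq iS => ->.
  by ring.
rewrite big_split exchange_big /=.
have -> : \sum_(j in S) \sum_(i | i \notin S) o i j = \sum_(j in S)
    (a j ^+ s * model_dn (S :\ j) j *
     model_op (YX true tt r) v (S :\ j) - d j).
  apply: eq_bigr => j jS; rewrite ffunE.
  rewrite [in RHS](bigD1 j) ?inE ?eqxx //= mulrDr.
  rewrite finset.setD1K // addrAC [X in _ = X + _](_ : _ = 0) ?add0r; last first.
    rewrite /d; have -> : j |: S = S by apply/finset.setUidPr; rewrite finset.sub1set.
    by rewrite exprD; ring.
  rewrite mulr_sumr; apply: eq_big => [i|i iS].
    by rewrite !inE; case: (eqVneq i j) => [->|]; rewrite ?jS ?andbT.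
  by rewrite /o model_up_dn //; ring.
rewrite sumrB addrCA; congr (_ + _).
rewrite /model_wt mulr_suml [RHS](bigID (mem S)) /= addrC; congr (_ + _).
  by rewrite -sumrN; apply: eq_bigr => i iS; rewrite iS mulN1r !mulNr.
by apply: eq_bigr => i iS; rewrite (negPf iS) mul1r.
Qed.

Definition model_num S : {poly C} :=
  \prod_i ('X - (a i + (if i \in S then hbar else - hbar))%:P).
Definition model_den : {poly C} := \prod_i ('X - (a i)%:P).
Definition model_series S (n : nat) : C^o :=
  if n is r.+1 then hbar * model_wt r S else 1.

Let res S i : C := (if i \in S then - hbar else hbar) *
  (model_dn (S :\ i) i * model_up (i |: S) i).

Let cofac i : {poly C} := \prod_(j | j != i) ('X - (a j)%:P).

Lemma horner_model_num S i : (model_num S).[a i] = res S i * (cofac i).[a i].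
Proof.
rewrite /model_num (bigD1 i) //= hornerM hornerXsubC opprD addrA subrr sub0r.
rewrite fun_if opprK [in X in X * _](_ : - hbar = - hbar) // /res -mulrA.
congr (_ * _).
rewrite horner_prod /cofac horner_prod (bigID (mem S)) /=.
rewrite [X in _ = _ * X](bigID (mem S)) /= mulrACA; congr (_ * _).
  rewrite (_ : model_dn _ _ = \prod_(k | (k != i) && (k \in S))
      ((a i - a k - hbar) / (a i - a k))); last by apply: eq_bigl => k; rewrite !inE.
  rewrite -big_split /=; apply: eq_bigr => k /andP [ki kS].
  by rewrite !hornerXsubC kS divfK ?a_neq 1?eq_sym // opprD addrA.
rewrite (_ : model_up _ _ = \prod_(k | (k != i) && (k \notin S))
    ((a i - a k + hbar) / (a i - a k))); last by apply: eq_bigl => k; rewrite !inE negb_or.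
rewrite -big_split /=; apply: eq_bigr => k /andP [ki kS].
by rewrite !hornerXsubC (negPf kS) divfK ?a_neq 1?eq_sym // opprD addrA opprK.
Qed.

(** Both sides are monic of degree m, so their difference has degree below m; it vanishes at the m
    distinct points a_i. *)
Lemma model_num_partial_fractions S :
  model_num S = model_den + \sum_i res S i *: cofac i.
Proof.
apply/eqP; rewrite -subr_eq0; set D := _ - _.
have sz_prod (Q : pred 'I_m) (F : 'I_m -> C) :
    size (\prod_(j | Q j) ('X - (F j)%:P)) = #|Q|.+1.
  rewrite size_prod => [|j _]; last by rewrite polyXsubC_eq0.
  under eq_bigr do rewrite size_XsubC.
  by rewrite sum_nat_const muln2 -addnn -addnS addKn.
have sz_num : size (model_num S) = m.+1 by rewrite sz_prod card_ord.
have sz_den : size model_den = m.+1 by rewrite sz_prod card_ord.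
have lead (p : {poly C}) : p \is monic -> size p = m.+1 -> p`_m = 1.
  by move=> /monicP pm sp; rewrite -[RHS]pm lead_coefE sp.
have sz_cof i : (size (cofac i) <= m)%N.
  by rewrite sz_prod (cardC1 i) card_ord prednK // (leq_ltn_trans _ (ltn_ord i)).
have szD : (size D <= m)%N.
  apply/leq_sizeP => k mk; rewrite /D coefB coefD coef_sum.
  rewrite [X in _ - (_ + X)]big1 ?addr0 => [|i _]; last first.
    by rewrite coefZ (nth_default 0 (leq_trans (sz_cof i) mk)) mulr0.
  move: mk; rewrite leq_eqVlt => /predU1P [<-|mk].
    by rewrite !lead ?monic_prod_XsubC ?subrr.
  by rewrite !nth_default ?sz_num ?sz_den ?subrr.
apply/eqP; apply: contraTeq szD => D0; rewrite -ltnNge.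
have := @max_poly_roots _ D [seq a i | i <- enum 'I_m] D0.
rewrite size_map -cardE card_ord map_inj_uniq // enum_uniq; apply=> //.
apply/allP => _ /mapP [i _ ->]; rewrite rootE /D hornerD hornerN hornerD.
rewrite horner_model_num horner_sum (bigD1 i) //= big1 => [|j ji].
  have -> : model_den.[a i] = 0.
    by rewrite /model_den horner_prod (bigD1 i) //= hornerXsubC subrr mul0r.
  by rewrite hornerZ addr0 add0r subrr.
rewrite hornerZ (_ : (cofac j).[a i] = 0) ?mulr0 //.
by rewrite /cofac horner_prod (bigD1 i) 1?eq_sym //= hornerXsubC subrr mul0r.
Qed.

(** In the partial fractions of [model_num S] over [model_den], each 1/(u - a_i) expands into a
    geometric series, and the sums of these are the [model_wt]. *)
Lemma model_seriesP S (n : int) :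
  shact nxz model_den (of_series (model_series S)) n = lpoly (model_num S) n.
Proof.
pose geo b : int -> C^o := of_series (fun n : nat => if n is r.+1 then b ^+ r else 0 : C^o).
have geoP b (k : int) : shact nxz ('X - b%:P) (geo b) k = lpoly 1 k.
  rewrite shact_XsubC; case: k => [[|k]|[|k]].
  - by rewrite /nxz /= scaler0 subr0 coef1.
  - by rewrite /nxz -PoszD addn1 /= -[_ *: _]/(_ * _) exprS subrr.
  - by rewrite /nxz /= scaler0 subr0 coef1.
  - rewrite (_ : nxz (Negz k.+1) = Negz k) /= ?scaler0 ?subr0 ?coef1 //.
    by rewrite /nxz !NegzE -[k.+2]addn1 PoszD opprD addrNK.
have -> : shact nxz model_den (of_series (model_series S)) n =
    shact nxz model_den (fun k : int => lpoly 1 k + \sum_i res S i *: geo (a i) k) n.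
  apply: eq_shact => -[[|k]|k] /=; rewrite ?coef1.
  - by rewrite big1 ?addr0 // => i _; rewrite scaler0.
  - rewrite add0r mulr_sumr; apply: eq_bigr => i _; rewrite /res.
    by rewrite -[_ *: _]/(_ * _); case: ifP => _; ring.
  - by rewrite big1 ?addr0 // => i _; rewrite scaler0.
rewrite model_num_partial_fractions lpolyD shactDr lact_lpoly mulr1; congr (_ + _).
rewrite shact_sumr (big_morph (fun p => lpoly p n) (fun p q => lpolyD p q n) (id1 := 0)); last first.
  by case: (n) => [[|k]|k]; rewrite /= ?coef0.
apply: eq_bigr => i _; rewrite shactZr lpolyZ; congr (_ *: _).
rewrite /model_den (bigD1 i) //= mulrC shactM (eq_shact nxz _ (geoP (a i))).
by rewrite lact_lpoly mulr1.
Qed.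

(** The eigenvalues at S and at S' = S without i differ only in the factor at a_i. So (u - a_i +
    hbar) xi_S(u) = (u - a_i - hbar) xi_S'(u), and the claims are its coefficients of u^0 and
    u^(-r-1). *)
Lemma model_wt_step S i r : i \in S ->
  model_wt 0 S = model_wt 0 (S :\ i) - 2 /\
  model_wt r.+1 S - model_wt r.+1 (S :\ i) - a i * (model_wt r S - model_wt r (S :\ i)) =
  - hbar * (model_wt r S + model_wt r (S :\ i)).
Proof.
move=> iS; set S' := S :\ i.
pose D (n : int) : C^o := shact nxz ('X - (a i - hbar)%:P) (of_series (model_series S)) n
  + (-1) *: shact nxz ('X - (a i + hbar)%:P) (of_series (model_series S')) n.
have D0 : D =1 (fun=> 0).
  apply: (@lact_inj _ _ [seq a j | j <- enum 'I_m] D (-1)).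
    move=> [n|[|n]] // _; rewrite /D !shact_XsubC.
    rewrite (_ : nxz (Negz n.+1) = Negz n) /= ?scaler0 ?subrr ?scaler0 ?addr0 //.
    by rewrite /nxz !NegzE -[n.+2]addn1 PoszD opprD addrNK.
  move=> n; rewrite big_map big_enum -/model_den /D shactDr shactZr -!shactM.
  rewrite ![model_den * _]mulrC !shactM !(eq_shact nxz _ (model_seriesP _)).
  rewrite !lact_lpoly scaleN1r; apply/eqP; rewrite subr_eq0; apply/eqP.
  congr (lpoly _ n); rewrite /model_num (bigD1 i) //= [in RHS](bigD1 i) //=.
  rewrite iS !inE eqxx mulrCA; congr (_ * (_ * _)).
  by apply: eq_bigr => j /negPf ji; rewrite !inE ji.
have := D0 0; have := D0 r.+1.
rewrite /D !shact_XsubC /nxz -PoszD addn1 /= !scaleN1r -![_ *: _]/(_ * _).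
move=> Er E0; split; apply: (mulfI hbar_neq0).
  apply/eqP; rewrite -subr_eq0 -E0; apply/eqP; ring.
apply/eqP; rewrite -subr_eq0 -Er; apply/eqP; ring.
Qed.

Lemma model_xi0_xm s (v : V) :
  model_op (YXi tt 0) (model_op (YX false tt s) v) =
  model_op (YX false tt s) (model_op (YXi tt 0) v) - 2 *: model_op (YX false tt s) v.
Proof.
apply/ffunP => S; rewrite !ffunE mulr_sumr scaler_sumr -sumrB.
apply: eq_bigr => i iS; rewrite ffunE (model_wt_step 0 iS).1.
by rewrite -[_ *: _]/(_ * _); ring.
Qed.

Lemma model_xi_xm r s (v : V) :
  model_op (YXi tt r.+1) (model_op (YX false tt s) v) =
    model_op (YX false tt s) (model_op (YXi tt r.+1) v)
    + model_op (YXi tt r) (model_op (YX false tt s.+1) v)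
    - model_op (YX false tt s.+1) (model_op (YXi tt r) v)
    - hbar *: (model_op (YXi tt r) (model_op (YX false tt s) v)
               + model_op (YX false tt s) (model_op (YXi tt r) v)).
Proof.
apply/ffunP => S; rewrite !ffunE !mulr_sumr -!big_split -!sumrB scaler_sumr -sumrB.
apply: eq_bigr => i iS; rewrite !ffunE exprS.
have := (model_wt_step r iS).2 => E.
have {}E : model_wt r.+1 S = model_wt r.+1 (S :\ i) +
    a i * (model_wt r S - model_wt r (S :\ i)) - hbar * (model_wt r S + model_wt r (S :\ i)).
  by rewrite -mulNr -E; ring.
by rewrite E -[_ *: _]/(_ * _) /=; ring.
Qed.

Definition model_Om : V := [ffun S => (S == finset.set0)%:R].

Lemma model_hw_module : hw_module hbar (fun r => model_wt r finset.set0) model_op model_Om.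
Proof.
split.
- exact: model_op_linear.
- exact: model_xp_xm.
- exact: model_xi0_xm.
- exact: model_xi_xm.
- move=> r; apply/ffunP => S; rewrite !ffunE big1 // => i _; rewrite ffunE.
  rewrite (_ : _ == _ = false) ?mulr0 //; apply/negbTE/set0Pn; exists i.
  by rewrite !inE eqxx.
- move=> r; apply/ffunP => S; rewrite !ffunE -[_ *: _]/(_ * _).
  by case: eqVneq => [->|_]; rewrite ?mulr0.
Qed.

Lemma model_vacuum : vacuum model_op model_Om (fun v : V => v finset.set0).
Proof.
split; first by move=> c u v; rewrite !ffunE.
- by rewrite ffunE eqxx.
- by move=> r v; rewrite ffunE big_pred0 // => i; rewrite inE.
Qed.

(** At each set the values are sums of geometric sequences whose ratios a_i are roots of
    [model_den]. *)
Lemma model_x_ann e (v : V) : ann S model_den (fun r => model_op (YX e tt r) v).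
Proof.
move=> n; apply/ffunP => T; rewrite /shact sum_ffunE.
have pa (Q : pred 'I_m) (c : 'I_m -> C^o) :
    shact S model_den (fun r => \sum_(i | Q i) a i ^+ r * c i : C^o) n = 0.
  rewrite shact_sumr big1 // => i _; rewrite (shact_geom _ (b := a i)) => [|k].
    rewrite /model_den horner_prod (bigD1 i) //= hornerXsubC subrr mul0r.
    exact: scale0r.
  by rewrite exprS -mulrA.
pose f r : C^o := model_op (YX e tt r) v T.
rewrite (_ : \sum_(j < _) _ = shact S model_den f n); last first.
  by apply: eq_bigr => j _; rewrite ffunE.
pose c i : C^o := if e then model_up (i |: T) i * v (i |: T) else model_dn (T :\ i) i * v (T :\ i).
rewrite ffunE -[RHS](pa (fun i => if e then i \notin T else i \in T) c).
apply: eq_shact => k; rewrite /f /c; case: (e); rewrite ffunE; apply: eq_bigr => i _;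
  by rewrite mulrA.
Qed.

Let bottom : V := iter m (model_op (YX false tt 0)) model_Om.

(** Each application of x^-_0 adds one element to the sets in the support, so after m steps only the
    full set remains. This makes [bottom] an eigenvector of xi(u). *)
Lemma model_bottomE T : T != [set: 'I_m] -> bottom T = 0.
Proof.
suff H (k : nat) (U : {set 'I_m}) : #|U| != k -> iter k (model_op (YX false tt 0)) model_Om U = 0.
  move=> nT; apply: H; apply: contraNneq nT => cT.
  by rewrite eqEcard finset.subsetT cardsT card_ord cT leqnn.
elim: k U => [|k IHk] U; first by rewrite cards_eq0 ffunE => /negPf ->.
move=> cU; rewrite /= ffunE big1 // => i iU; rewrite IHk ?mulr0 //.
by apply: contraNneq cU => <-; rewrite (cardsD1 i U) iU.
Qed.

Lemma model_bottomP (n : int) :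
  shact nxz model_den (of_series (fun l : nat =>
    if l is r.+1 then hbar *: model_op (YXi tt r) bottom else bottom)) n =
  lpoly (\prod_i ('X - (a i + hbar)%:P)) n *: bottom.
Proof.
have -> : \prod_i ('X - (a i + hbar)%:P) = model_num [set: 'I_m].
  by apply: eq_bigr => i _; rewrite inE.
rewrite -model_seriesP /shact scaler_suml; apply: eq_bigr => j _.
rewrite -scalerA; congr (_ *: _).
case: (iter j nxz n) => [[|r]|r] /=; rewrite ?scale1r ?scale0r //.
apply/ffunP => T; rewrite !ffunE -![_ *: _]/(_ * _).
by have [->|/model_bottomE ->] := eqVneq T [set: 'I_m]; rewrite ?mulr0 ?mulrA.
Qed.

End SubsetModel.

(** * Drinfeld polynomials *)

Section ExpansionUniqueness.
Variable C : closedFieldType.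
Implicit Types (U : lmodType C) (p q : {poly C}).

Lemma expansion_lact U (X : nat -> U) q (N : nat -> U) : expansion X q N ->
  shact nxz q (of_series X) =1 of_poly N.
Proof.
move=> [_ qN qX] n; rewrite /shact.
have iterE (j : nat) : iter j nxz n = n + j%:Z.
  by elim: j => [|j IHj]; rewrite ?addr0 // iterS IHj /nxz -addn1 PoszD addrA.
have pos k : \sum_(j < size q) q`_j *: of_series X (Posz k.+1 + j%:Z) = 0.
  by rewrite -[RHS](qX k); apply: eq_bigr => j _; rewrite -PoszD addnC.
have neg k : \sum_(j < size q) q`_j *: of_series X (j%:Z - k%:Z) = N k.
  rewrite -qN big_geq_mkord big_mkcond /= [RHS]big_mkcond; apply: eq_bigr => j _.
  case: leqP => [kj|jk]; first by rewrite subzn.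
  rewrite -opprB subzn 1?ltnW //.
  move: (jk); rewrite -subn_gt0; case: (k - j)%N => // l _.
  by rewrite -NegzE scaler0.
under eq_bigr do rewrite iterE.
case: n {iterE} => [[|k]|k]; [|exact: pos|].
- by rewrite -[RHS]/(N 0%N) -neg; apply: eq_bigr => j _; rewrite addrC.
- by rewrite -[RHS]/(N k.+1) -neg; apply: eq_bigr => j _; rewrite NegzE addrC.
Qed.

Lemma series_unique U (X X' : nat -> U) (rs : seq C) :
  shact nxz (\prod_(a <- rs) ('X - a%:P)) (of_series X) =1
    shact nxz (\prod_(a <- rs) ('X - a%:P)) (of_series X') -> X =1 X'.
Proof.
move=> XX' n; pose D k := of_series X k + (-1) *: of_series X' k.
have /(_ n)/eqP : D =1 (fun=> 0).
  apply: (@lact_inj _ _ rs _ 0) => [[k|k]|k] //.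
    by rewrite /D /= scaler0 addr0.
  by rewrite /D shactDr shactZr XX' scaleN1r subrr.
by rewrite /D scaleN1r subr_eq0 => /eqP.
Qed.

End ExpansionUniqueness.

(** * Highest weight representations and the vacuum functional *)

Section HighestWeightRep.
Variables (C : numClosedFieldType) (hbar : C) (L : rep (Yangian_sl2 hbar)).
Local Notation Y := (Yangian_sl2 hbar).
Local Notation rho := (rep_act L).

Definition rep_op (z : ygen unit) (v : L) : L :=
  rho (pres_gen (yang_rel (@sl2_gram C) hbar) z) v.

Lemma tact_rep z v : tact rep_op z v = rho (pres_class (yang_rel (@sl2_gram C) hbar) z) v.
Proof.
elim: z v => [g|c|t IHt u IHu|t IHt u IHu] v //=.
- rewrite -[pres_class _ _](mulr1 (pres_class _ (AScal c) : Y)).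
  rewrite -[_ * 1]/(c *: (1 : Y)) linearZ /= rep_act1 scale_lfunE id_lfunE //.
- rewrite IHt IHu -(pres_addE _ t u) -[pres_add _ _]/(_ + _ : Y) linearD /=.
  by rewrite add_lfunE.
- rewrite IHu IHt -(pres_mulE _ t u) -[pres_mul _ _]/(_ * _ : Y).
  by rewrite rhoM.
Qed.

Lemma rep_hw_module lam (Om : L) :
  (forall r, rho (sl2_x hbar true r) Om = 0) ->
  (forall r, rho (sl2_xi hbar r) Om = lam r *: Om) -> hw_module hbar lam rep_op Om.
Proof.
have [r0 r1 r2] := Yangian_sl2_relations hbar.
move=> xOm xiOm; split=> // [g c u v|r s v|s v|r s v]; first exact: linearP.
- have := congr1 (fun z => rho z v) (r2 true r s).
  by rewrite rho_br scale1r /rep_op => /eqP; rewrite subr_eq addrC => /eqP.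
- have := congr1 (fun z => rho z v) (r0 false s).
  rewrite rho_br rhoZ mulN1r scaleNr => /eqP.
  by rewrite subr_eq addrC => /eqP.
- have := congr1 (fun z => rho z v) (r1 false r s).
  rewrite rhoB !rho_br rhoZ rhoD !rhoM mulN1r scaleNr => /eqP.
  rewrite subr_eq => /eqP/eqP; rewrite subr_eq => /eqP E.
  by rewrite /rep_op [LHS]E addrC [- _ + _]addrC !addrA.
Qed.

Section Cyclic.
Variables (lam : nat -> C) (Om : L).
Hypothesis hw : hw_module hbar lam rep_op Om.
Hypothesis cyclic_Om : forall v, exists y, v = rho y Om.

Lemma cyclic_span v : exists s : seq (C * seq nat),
  v = \sum_(c <- s) c.1 *: xm_word rep_op Om c.2.
Proof.
have [y ->] := cyclic_Om v; rewrite -[y]pres_reprK -tact_rep.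
(* The given highest weight is viewed as a constant family, and the normal form is evaluated at t =
   0. *)
have [s sE] := @tact_span C hbar (fun r => (lam r)%:P) (repr y)%qT.
exists [seq (c.1.[0], c.2) | c <- s]; rewrite big_map; apply: sE.
by rewrite (_ : (fun r => _) = lam) //; apply/funext => r; rewrite hornerC.
Qed.

Lemma cyclic_ind (phi psi : L -> C) :
    (forall a u v, phi (a *: u + v) = a * phi u + phi v) ->
    (forall a u v, psi (a *: u + v) = a * psi u + psi v) ->
    (forall l, phi (xm_word rep_op Om l) = psi (xm_word rep_op Om l)) ->
  phi =1 psi.
Proof.
move=> phil psil E v; have [s ->] := cyclic_span v.
have z0 (f : L -> C) : (forall a u v, f (a *: u + v) = a * f u + f v) -> f 0 = 0.
  move=> fl; have := fl (-1) 0 0; rewrite scaler0 addr0 => /eqP.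
  by rewrite mulN1r addNr => /eqP.
elim: s => [|c s IHs]; first by rewrite big_nil !z0.
by rewrite big_cons phil psil E IHs.
Qed.

(** Strip a polynomial annihilating xi_0 of all factors u - lambda, where lambda is [lam 0]. What
    remains, evaluated at xi_0, kills the words of positive length, whose weights are lambda - 2k
    with k > 0, and multiplies [Om] by a nonzero number. Then a linear form equal to 1 on [Om] is
    applied. *)
Lemma vacuum_exists : Om != 0 -> exists phi, vacuum rep_op Om phi.
Proof.
move=> Om0; set T := rep_op (YXi tt 0).
have Tl : linear T by move=> a u v; exact: linearP.
have [q q0 qT] := ann_iter Tl.
have [e [q1 q1l qE]] := multiplicity_XsubC q (lam 0%N).
rewrite q0 in q1l.
pose pr v := shact S q1 (fun n => iter n T v) 0.
have eig v mu : T v = mu *: v -> forall p, shact S p (fun n => iter n T v) 0 = p.[mu] *: v.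
  move=> Tv p; rewrite (shact_geom _ (b := mu)) // => n.
  have E k : iter k T v = mu ^+ k *: v.
    elim: k => [|k IHk]; first by rewrite scale1r.
    by rewrite iterS IHk /T /rep_op linearZ /= -/(rep_op _ _) -/T Tv scalerA exprSr.
  by rewrite !E scalerA exprS.
have prl : linear pr.
  move=> a u v; rewrite /pr /shact scaler_sumr -big_split; apply: eq_bigr => j _ /=.
  have -> : iter (iter j S 0) T (a *: u + v) = a *: iter (iter j S 0) T u + iter (iter j S 0) T v.
    by elim: (iter j S 0%N) => [//|n IHn]; rewrite !iterS IHn Tl.
  by rewrite scalerDr !scalerA mulrC.
have frOm : free [:: Om] by rewrite seq1_free.
pose cf v : C := coord [tuple Om] ord0 v.
pose c := q1.[lam 0%N].
have c0 : c != 0 by exact: q1l.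
exists (fun v => c^-1 * cf (pr v)); split=> [a u v||r v].
- by rewrite prl /cf linearP /= mulrDr mulrCA.
- have -> : pr Om = c *: Om by apply: eig; exact: hw_xi hw _.
  have cf1 : cf Om = 1 by have := coord_free (X := [tuple Om]) ord0 ord0 frOm; rewrite eqxx.
  by rewrite -[cf _]/(coord [tuple Om] ord0 (c *: Om)) linearZ /= -/(cf Om) cf1 mulr1 mulVf.
- suff: forall w, c^-1 * cf (pr (rep_op (YX false tt r) w)) = (fun=> 0) w by [].
  apply: cyclic_ind => [a u w|a u w|l]; [|by rewrite mulr0 addr0|].
    by rewrite /rep_op linearP /= prl /cf linearP /= mulrDr mulrCA.
  set w := rep_op _ _; have Tw : T w = (lam 0%N - 2 * (size l).+1%:R) *: w.
    exact: (xm_word_weight hw (r :: l)).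
  suff -> : pr w = 0 by rewrite /cf linear0 mulr0.
  rewrite /pr (eig _ _ Tw); have := qT w.
  rewrite (eig _ _ Tw) qE hornerM => /eqP; rewrite scaler_eq0 mulf_eq0 -orbA.
  case/or3P => [/eqP ->|h|/eqP ->]; rewrite ?scale0r ?scaler0 //.
  exfalso; move: h; rewrite horner_exp hornerXsubC expf_eq0 => /andP [_].
  by rewrite addrAC subrr add0r oppr_eq0 mulf_eq0 !pnatr_eq0.
Qed.

End Cyclic.

End HighestWeightRep.

(** * Transfer from distinct roots to arbitrary roots *)

Section Density.
Variables (C : numClosedFieldType) (hbar : C) (m : nat) (a : 'I_m -> C).
Hypothesis hbar_neq0 : hbar != 0.
Local Notation term := (aterm C (ygen unit)).

(* The roots a_i are moved apart along lines; they are distinct for generic t. *)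
Definition line (i : 'I_m) : {poly C} := (a i)%:P + i%:R *: 'X.
Definition line_at (t : C) (i : 'I_m) : C := (line i).[t].
Definition line_weight r : {poly C} :=
  hbar^-1 *: weight_series hbar%:P [seq line i | i <- enum 'I_m] r.+1.

Lemma line_at0 i : line_at 0 i = a i.
Proof. by rewrite /line_at hornerD hornerC hornerZ hornerX mulr0 addr0. Qed.

(** The product [B] of the differences of the lines is nonzero and vanishes wherever two roots meet,
    so g B vanishes at all natural numbers and is 0. *)
Lemma line_generic (g : {poly C}) :
  (forall t, injective (line_at t) -> g.[t] = 0) -> g = 0.
Proof.
move=> g0; pose B : {poly C} := \prod_(ij : 'I_m * 'I_m | ij.1 != ij.2) (line ij.1 - line ij.2).
have B0 : B != 0.
  apply/prodf_neq0 => -[i j] /= ij; apply/eqP => /(congr1 (fun p : {poly C} => p`_1)).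
  rewrite coef0 coefB !coefD !coefC !coefZ !coefX /= !add0r !mulr1 => /eqP.
  by rewrite subr_eq0 eqr_nat => /eqP/val_inj/eqP; rewrite (negPf ij).
suff /eqP : g * B = 0 by rewrite mulf_eq0 (negPf B0) orbF => /eqP.
apply/eqP; apply: contraT => gB.
have := @max_poly_roots _ _ [seq k%:R | k <- iota 0 (size (g * B))] gB.
rewrite size_map size_iota ltnn map_inj_uniq ?iota_uniq => [|j k /eqP]; last first.
  by rewrite eqr_nat => /eqP.
apply=> //; apply/allP => _ /mapP [k _ ->]; rewrite rootE hornerM.
have [t_inj|ninj] := pselect (injective (line_at k%:R)); first by rewrite g0 ?mul0r.
suff -> : B.[k%:R] = 0 by rewrite mulr0.
apply/eqP; apply: contraT => Bk; case: ninj => i j ij.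
apply: contraTeq Bk => ijn; rewrite negbK /B horner_prod.
rewrite (bigD1 (i, j)) //= hornerD hornerN -/(line_at _ i) -/(line_at _ j) ij.
by rewrite subrr mul0r.
Qed.

Lemma line_weightE t r : (line_weight r).[t] =
  hbar^-1 * weight_series hbar [seq line_at t i | i <- enum 'I_m] r.+1.
Proof.
rewrite hornerZ -[_.[t]]/(horner_eval t _) weight_series_morph -map_comp.
by rewrite /= /horner_eval hornerC.
Qed.

(** Both sides expand the same rational function, the product of the (u - b + hbar)/(u - b) over the
    moved roots b. *)
Lemma line_model_weight t : injective (line_at t) ->
  (fun r => (line_weight r).[t]) = (fun r => model_wt hbar (line_at t) r finset.set0).
Proof.
move=> t_inj; apply/funext => r; rewrite line_weightE.
apply: (mulfI hbar_neq0); rewrite mulVKf //.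
rewrite -[RHS]/(model_series hbar (line_at t) finset.set0 r.+1).
apply: (@series_unique _ _ (weight_series hbar [seq line_at t i | i <- enum 'I_m] : nat -> C^o)
  (model_series hbar (line_at t) finset.set0) [seq line_at t i | i <- enum 'I_m]) => n.
have prodE (F : C -> {poly C}) :
    \prod_(b <- [seq line_at t i | i <- enum 'I_m]) F b = \prod_i F (line_at t i).
  by rewrite big_map big_enum.
rewrite weight_seriesP !prodE -/(model_den _) (model_seriesP hbar t_inj).
by congr (lpoly _ n); apply: eq_bigr => i _; rewrite inE.
Qed.

Variable L : rep (Yangian_sl2 hbar).
Variable Om : L.
Hypotheses (irrL : irreducible L) (Om_neq0 : Om != 0).
Hypothesis cyclic_Om : forall v, exists y, v = rep_act L y Om.
Hypothesis hw : hw_module hbar (fun r => (line_weight r).[0]) (@rep_op _ _ L) Om.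

(* An identity between matrix coefficients that holds for generic t holds at
   t = 0, and a vector all of whose translates have vanishing vacuum component
   generates a proper subrepresentation. *)
Lemma density (J : finType) (c : J -> {poly C}) (z : J -> term) :
    (forall t, injective (line_at t) ->
      \sum_j (c j).[t] *: tact (model_op hbar (line_at t)) (z j) (model_Om C m) = 0) ->
  \sum_j (c j).[0] *: tact (@rep_op _ _ L) (z j) Om = 0.
Proof.
move=> cz0; have [phi vac] := vacuum_exists hw cyclic_Om Om_neq0.
set u := \sum_j _.
have phi_u w : phi (tact (@rep_op _ _ L) w u) = 0.
  have [p pE] := choice (fun j => vacuum_polynomial hbar line_weight (AMul w (z j))).
  (* [g] computes the coefficient in [L] at t = 0 and in the model at generic t, where it vanishes
     by assumption. *)
  pose g := \sum_j c j * p j.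
  have sumE (V : lmodType C) (op : ygen unit -> V -> V) (O : V) (f : V -> C) t :
      hw_module hbar (fun r => (line_weight r).[t]) op O -> vacuum op O f ->
      f (tact op w (\sum_j (c j).[t] *: tact op (z j) O)) = g.[t].
    move=> hwV vacV; have twl := tact_linear (hw_linear hwV) w.
    pose F : {linear V -> V} := HB.pack (tact op w) (GRing.isLinear.Build _ _ _ _ _ twl).
    rewrite -[tact op w _]/(F _) linear_sum -[f _]/(vac_fun vacV _) linear_sum /g horner_sum.
    apply: eq_bigr => j _; rewrite hornerM -(pE j t V op f O hwV vacV) /=.
    by rewrite -[tact op w _]/(F _) linearZ -[f _]/(vac_fun vacV _) linearZ.
  rewrite (sumE _ _ _ _ _ hw vac); suff -> : g = 0 by rewrite horner0.
  apply: line_generic => t t_inj.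
  have hwm : hw_module hbar (fun r => (line_weight r).[t]) (model_op hbar (line_at t)) (model_Om C m).
    by rewrite line_model_weight //; apply: model_hw_module.
  rewrite -(sumE _ _ _ _ _ hwm (model_vacuum _ _)) cz0 //.
  have twl := tact_linear (hw_linear hwm) w.
  pose F : {linear _ -> _} := HB.pack (tact _ w) (GRing.isLinear.Build _ _ _ _ _ twl).
  by rewrite -[tact _ w _]/(F _) linear0 ffunE.
pose Q v := forall y, phi (rep_act L y v) = 0.
have [U UQ] : exists U : {vspace L}, forall v, v \in U <-> Q v.
  apply: span_predicate => [y|b v w Qv Qw y].
    by rewrite linear0; exact: (linear0 (vac_fun vac)).
  by rewrite linearP /= (vac_linear vac) Qv Qw mulr0 addr0.
have subU : subrep U.
  by move=> y v /UQ Qv; apply/UQ => y'; rewrite -rhoM.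
have uU : u \in U.
  by apply/UQ => y; rewrite -[y]pres_reprK -tact_rep phi_u.
case: (irrL.2 U subU) => UE; first by move: uU; rewrite UE memv0 => /eqP.
have /UQ/(_ 1) : Om \in U by rewrite UE memvf.
by rewrite rep_act1 id_lfunE (vac_Om vac) => /eqP; rewrite oner_eq0.
Qed.

End Density.

Section DrinfeldModule.
Variables (C : numClosedFieldType) (hbar : C) (m : nat) (a : 'I_m -> C).
Hypothesis hbar_neq0 : hbar != 0.
Variable L : rep (Yangian_sl2 hbar).
Variable Om : L.
Hypotheses (irrL : irreducible L) (Om_neq0 : Om != 0).
Hypothesis cyclic_Om : forall v, exists y, v = rep_act L y Om.
Hypothesis hw : hw_module hbar (fun r => (line_weight hbar a r).[0]) (@rep_op _ _ L) Om.
Local Notation term := (aterm C (ygen unit)).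
Local Notation op := (@rep_op _ _ L).
Local Notation den := (model_den a).

Let PP : {poly {poly C}} := \prod_i ('X - (line a i)%:P).

Let PPE t j : (PP`_j).[t] = (model_den (line_at a t))`_j.
Proof.
rewrite -[_.[t]]/(horner_eval t _) -coef_map /PP rmorph_prod; congr ((_ : {poly C})`_j).
by apply: eq_bigr => i _; rewrite /= map_polyXsubC.
Qed.

Let size_den (b : 'I_m -> C) : (size (model_den b) <= m.+1)%N.
Proof.
rewrite /model_den size_prod => [|j _]; last by rewrite polyXsubC_eq0.
under eq_bigr do rewrite size_XsubC.
by rewrite sum_nat_const muln2 -addnn -addnS addKn card_ord.
Qed.

Let line0 : line_at a 0 = a.
Proof. by apply/funext => i; rewrite line_at0. Qed.

Lemma drinfeld_x_ann e : ann S den (rep_act L \o sl2_x hbar e).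
Proof.
move=> n; apply/lfunP => v; rewrite zero_lfunE; have [y ->] := cyclic_Om v.
rewrite -[y]pres_reprK -tact_rep; set z := repr y.
have := @density _ _ _ a hbar_neq0 L Om irrL Om_neq0 cyclic_Om hw
  ('I_m.+1 : finType) (fun j => PP`_j) (fun j => AMul (AGen (YX e tt (iter j S n))) z).
move=> dens; rewrite -[RHS]dens => [|t t_inj].
  rewrite (shact_widen _ _ _ (size_den a)) sum_lfunE; apply: eq_bigr => j _.
  by rewrite scale_lfunE PPE line0.
rewrite -[RHS](model_x_ann hbar (line_at a t) e
  (tact (model_op hbar (line_at a t)) z (model_Om C m)) n).
rewrite (shact_widen _ _ _ (size_den _)); apply: eq_bigr => j _.
by rewrite PPE.
Qed.

Let zb : term := iter m (AMul (AGen (YX false tt 0))) (AScal 1).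

Let tact_zb (V : lmodType C) (p : ygen unit -> V -> V) (O : V) :
  tact p zb O = iter m (p (YX false tt 0)) O.
Proof. by rewrite /zb; elim: m => [|k IHk] /=; rewrite ?scale1r ?IHk. Qed.

Let zs (k : int) : term :=
  match k with
  | Posz 0 => zb
  | Posz r.+1 => AMul (AScal hbar) (AMul (AGen (YXi tt r)) zb)
  | Negz _ => AScal 0
  end.

Definition eigen_series (V : lmodType C) (p : ygen unit -> V -> V) (v : V) (l : nat) : V :=
  if l is r.+1 then hbar *: p (YXi tt r) v else v.

Let tact_zs (V : lmodType C) (p : ygen unit -> V -> V) (O : V) k :
  tact p (zs k) O = of_series (eigen_series p (iter m (p (YX false tt 0)) O)) k.
Proof. by case: k => [[|r]|r] /=; rewrite ?tact_zb ?scale0r. Qed.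

Definition bottom_vec : L := iter m (op (YX false tt 0)) Om.

Lemma bottom_vec_series (n : int) :
  shact nxz den (of_series (eigen_series op bottom_vec)) n =
  lpoly (\prod_i ('X - (a i + hbar)%:P)) n *: bottom_vec.
Proof.
pose QQ : {poly {poly C}} := \prod_i ('X - (line a i + hbar%:P)%:P).
pose cn : {poly C} := of_poly (fun k => QQ`_k) n.
have cnE t : cn.[t] = lpoly (\prod_i ('X - (line_at a t i + hbar)%:P)) n.
  have E k : (QQ`_k).[t] = (\prod_i ('X - (line_at a t i + hbar)%:P))`_k.
    rewrite -[_.[t]]/(horner_eval t _) -coef_map /QQ rmorph_prod; congr ((_ : {poly C})`_k).
    by apply: eq_bigr => i _; rewrite /= map_polyXsubC /= /horner_eval hornerD hornerC.
  by rewrite /cn; case: (n) => [[|k]|k] /=; rewrite ?horner0 ?E.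
(* The last index carries the right-hand side, so that the identity becomes the vanishing of one sum
   of m + 2 terms. *)
have := @density _ _ _ a hbar_neq0 L Om irrL Om_neq0 cyclic_Om hw
  ('I_m.+2 : finType) (fun j => if (j < m.+1)%N then PP`_j else - cn)
  (fun j => if (j < m.+1)%N then zs (iter j nxz n) else zb).
have sumE (V : lmodType C) (p : ygen unit -> V -> V) (O : V) t :
    \sum_(j < m.+2) (if (j < m.+1)%N then PP`_j else - cn).[t] *:
      tact p (if (j < m.+1)%N then zs (iter j nxz n) else zb) O =
    shact nxz (model_den (line_at a t))
      (of_series (eigen_series p (iter m (p (YX false tt 0)) O))) n -
    lpoly (\prod_i ('X - (line_at a t i + hbar)%:P)) n *: iter m (p (YX false tt 0)) O.
  rewrite big_ord_recr /= ltnn hornerN cnE scaleNr tact_zb; congr (_ - _).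
  rewrite (shact_widen _ _ _ (size_den _)); apply: eq_bigr => j _.
  by rewrite ltn_ord PPE tact_zs.
rewrite sumE line0 => dens; apply/eqP; rewrite -subr_eq0; apply/eqP/dens => t t_inj.
by rewrite sumE (model_bottomP _ t_inj) subrr.
Qed.

Let lam0 : (line_weight hbar a 0).[0] = m%:R.
Proof.
rewrite line_weightE; apply: (mulfI hbar_neq0); rewrite mulVKf //.
have E (bs : seq C) : weight_series hbar bs 1 = hbar * (size bs)%:R.
  elim: bs => [|b bs IHbs] /=; first by rewrite mulr0.
  by rewrite IHbs big_ord1 /= weight_series0 expr0 !mulr1 -natr1 mulrDr mulr1.
by rewrite E size_map -cardE card_ord.
Qed.

(** The highest weight is m, so by [xp_xm_power] x^+_0 takes (x^-_0)^(k+1) Om to (k+1)(m-k)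
    (x^-_0)^k Om, with a nonzero coefficient for k < m. *)
Lemma bottom_vec_neq0 : bottom_vec != 0.
Proof.
suff H k : (k <= m)%N -> iter k (op (YX false tt 0)) Om != 0 by apply: H.
elim: k => [//|k IHk] km; apply: contraNneq (IHk (ltnW km)) => E.
have := xp_xm_power hw k; rewrite E lam0 -natrB ?(ltnW km) // => /esym.
rewrite [op _ 0](_ : _ = 0); last by rewrite /rep_op linear0.
move/eqP; rewrite scaler_eq0 mulf_eq0 !pnatr_eq0 /= subn_eq0 leqNgt km /=.
by [].
Qed.

Local Notation lam := (fun r => (line_weight hbar a r).[0]).

Definition eigenvalue_series (mu : nat -> C) (n : nat) : C^o :=
  if n is r.+1 then hbar * mu r else 1.

(** By irreducibility [w] generates L, so the vacuum functional is nonzero on [w]: otherwise it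
    would vanish on all words in x^- applied to [w]. Evaluating it on xi_r w in two ways compares
    the eigenvalues. *)
Lemma singular_eigenvalue w mu : w != 0 ->
  (forall r, rep_act L (sl2_x hbar true r) w = 0) ->
  (forall r, rep_act L (sl2_xi hbar r) w = mu r *: w) -> mu = lam.
Proof.
move=> w0 xw xiw; have hww := rep_hw_module xw xiw.
have [phi vac] := vacuum_exists hw cyclic_Om Om_neq0.
have cyc_w v : exists y, v = rep_act L y w.
  have [U UQ] : exists U : {vspace L}, forall v, v \in U <-> exists y, v = rep_act L y w.
    apply: span_predicate => [|b u u' [y ->] [y' ->]].
      by exists 0; rewrite linear0 zero_lfunE.
    by exists (b *: y + y'); rewrite rhoD rhoZ.
  have subU : subrep U.
    by move=> y u /UQ [y' ->]; apply/UQ; exists (y * y'); rewrite rhoM.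
  apply/UQ; case: (irrL.2 U subU) => [UE|->]; last exact: memvf.
  have wU : w \in U by apply/UQ; exists 1; rewrite rep_act1 id_lfunE.
  by exfalso; move: wU; rewrite UE memv0 (negPf w0).
have phi_xi r : (fun v => phi (op (YXi tt r) v)) =1 (fun v => lam r * phi v).
  apply: (cyclic_ind hw cyclic_Om) => [b u v|b u v|[|k l]].
  - by rewrite /rep_op linearP /= (vac_linear vac).
  - by rewrite (vac_linear vac) mulrDr mulrCA.
  - by rewrite /= (hw_xi hw) (vacZ vac).
  - by rewrite /= (vac_xi_xm hw vac) (vac_xm vac) mulr0.
have phiw : phi w != 0.
  apply/eqP => phiw; have := vac_Om vac.
  have -> : phi Om = (fun=> 0) Om.
    apply: (@cyclic_ind _ _ _ _ _ hww cyc_w phi (fun=> 0)) => [|b u v|[|k l]].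
    - exact: vac_linear vac.
    - by rewrite mulr0 addr0.
    - exact: phiw.
    - exact: vac_xm vac _ _.
  by move=> /esym/eqP; rewrite oner_eq0.
apply/funext => r; apply: (mulIf phiw).
by rewrite -(phi_xi r w) /rep_op -[rep_act _ _ w]/(rep_act L (sl2_xi hbar r) w) xiw (vacZ vac).
Qed.

(* Each step passes to the leading coefficient of x^+(u) w at a pole b, which
   multiplies the eigenvalue of xi(u) by (u - b + hbar) / (u - b - hbar). *)
Lemma climb N w mu : w != 0 ->
    (forall r, rep_act L (sl2_xi hbar r) w = mu r *: w) ->
    (forall v, rep_act L (sl2_xi hbar 0) v = (mu 0%N + 2 * N%:R) *: v -> v = 0) ->
  exists bs : seq C, (forall b, b \in bs -> ~ regular (sl2_x hbar) L b) /\
    shact nxz (\prod_(b <- bs) ('X - (b + hbar)%:P)) (of_series (eigenvalue_series lam)) =1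
    shact nxz (\prod_(b <- bs) ('X - (b - hbar)%:P)) (of_series (eigenvalue_series mu)).
Proof.
have rel := Yangian_sl2_relations hbar.
(* [N] limits the climb: each step raises the weight by 2, and the weight mu_0 + 2N does not
   occur. *)
elim: N w mu => [|N IHN] w mu w0 xiw bound.
  by move: w0; rewrite (bound w) ?eqxx // mulr0 addr0.
have [xw|nxw] := pselect (forall r, rep_act L (sl2_x hbar true r) w = 0).
  exists [::]; split=> // n; rewrite !big_nil.
  by rewrite (singular_eigenvalue w0 xw xiw).
have [r xrw] : exists r, rep_act L (sl2_x hbar true r) w != 0.
  apply: contrapT => nex; apply: nxw => r; apply/eqP; apply: contraT => xr.
  by case: nex; exists r.
pose f n := rep_act L (sl2_x hbar true n) w.
have kills_f q : ann S q (rep_act L \o sl2_x hbar true) -> ann S q f.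
  move=> qx n; have := congr1 (fun g : 'End(L) => g w) (qx n).
  rewrite zero_lfunE sum_lfunE => <-; apply: eq_bigr => j _.
  by rewrite scale_lfunE.
have rat_f : exists2 q : {poly C}, q != 0 & ann S q f.
  by have [q q0 qx] := x_rational rel L true; exists q => //; exact: kills_f.
have [b [p [y [y0 py]]]] := nonzero_geometric rat_f (xrw : f r != 0).
have nreg_b : ~ regular (sl2_x hbar) L b.
  by move=> /(_ true) [q /negP qb /kills_f qf]; apply: qb; apply: geometric_root py y0 qf.
have actw n : rep_act L (shact S p (sl2_x hbar true) n) w = b ^+ n *: y.
  rewrite -py /shact linear_sum sum_lfunE; apply: eq_bigr => j _.
  by rewrite linearZ scale_lfunE.
(* The recursion is the coefficient form of (u - b - hbar) mu'(u) = (u - b + hbar) mu(u). *)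
pose mu' := fix mu' r := if r is k.+1
  then mu k.+1 + (b + hbar) * mu' k + (hbar - b) * mu k else mu 0%N + 2.
have y_eq : y = rep_act L (shact S p (sl2_x hbar true) 0) w by rewrite actw scale1r.
have xiy k : rep_act L (sl2_xi hbar k) y = mu' k *: y.
  elim: k => [|k IHk].
    have := congr1 (fun z => rep_act L z w) (sl2_xi0_act rel p true 0).
    rewrite rho_br rhoZ xiw linearZ /= -!y_eq mul1r => /eqP.
    by rewrite subr_eq -scalerDl addrC => /eqP.
  have := congr1 (fun z => rep_act L z w) (sl2_xi_act rel p true k 0).
  rewrite rhoB !rho_br rhoZ rhoD !rhoM !xiw !linearZ /= !actw !linearZ /= !expr0 !scale1r.
  rewrite expr1 mul1r IHk scalerN => /eqP; rewrite !subr_eq => /eqP ->.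
  rewrite !scalerDr !scalerN !scalerA -!scaleNr -!scalerDl.
  by congr (_ *: _); ring.
have [|bs [bsP E]] := IHN y mu' y0 xiy.
  move=> v /= xiv; apply: bound; rewrite xiv; congr (_ *: _).
  by rewrite -natr1; ring.
have step n : shact nxz ('X - (b + hbar)%:P) (of_series (eigenvalue_series mu')) n =
    shact nxz ('X - (b - hbar)%:P) (of_series (eigenvalue_series mu)) n.
  rewrite !shact_XsubC; case: n => [[|k]|[|k]].
  - by rewrite /nxz /= -![_ *: _]/(_ * _); ring.
  - by rewrite /nxz -PoszD addn1 /= -![_ *: _]/(_ * _); ring.
  - by rewrite /nxz /= !scaler0.
  - rewrite (_ : nxz (Negz k.+1) = Negz k) /= ?scaler0 //.
    by rewrite /nxz !NegzE -[k.+2]addn1 PoszD opprD addrNK.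
exists (b :: bs); split=> [b'|n]; first by rewrite inE => /predU1P [->//|/bsP].
rewrite !big_cons shactM (eq_shact nxz _ E) -shactM mulrC shactM.
by rewrite (eq_shact nxz _ step) -shactM mulrC.
Qed.

End DrinfeldModule.

(** Comparing multiplicities at y + h shows that the multiplicity in r minus that in s is invariant
    under translation by 2h. If it were positive at c, it would be so at all c + 2kh, infinitely
    many elements of the finite list r. *)
Lemma shifted_prod_perm (C : numClosedFieldType) (h : C) (r s : seq C) : h != 0 ->
  \prod_(b <- s) ('X - (b + h)%:P) * \prod_(b <- r) ('X - (b - h)%:P) =
  \prod_(b <- s) ('X - (b - h)%:P) * \prod_(b <- r) ('X - (b + h)%:P) ->
  {subset r <= s}.
Proof.
move=> h0 E c cr; apply: contraT => cs.
have cnt (t : seq C) (y k : C) : count_mem y [seq b + k | b <- t] = count_mem (y - k) t :> nat.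
  by rewrite count_map; apply: eq_count => b /=; rewrite [RHS]eq_sym subr_eq eq_sym.
have mupE (t : seq C) (k : C) : \prod_(b <- t) ('X - (b + k)%:P) =
    \prod_(b <- [seq b + k | b <- t]) ('X - b%:P) by rewrite big_map.
have step (y : C) : (count_mem y s + count_mem (y + h + h)%R r =
    count_mem (y + h + h)%R s + count_mem y r)%N.
  have := congr1 (mup (y + h)) E; rewrite !mupE -!big_cat !mu_prod_XsubC.
  by rewrite !count_cat !cnt opprK addrK.
have pos k : (count_mem (c + k%:R * (h + h))%R s < count_mem (c + k%:R * (h + h))%R r)%N.
  elim: k => [|k IHk].
    by rewrite mul0r addr0 (count_memPn cs) -has_count has_pred1.
  have -> : c + k.+1%:R * (h + h) = c + k%:R * (h + h) + h + h by rewrite -natr1; ring.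
  move: (step (c + k%:R * (h + h))) IHk; move: (count_mem _ _) (count_mem _ _).
  move=> x y; move: (count_mem _ _) (count_mem _ _) => x1 y1; lia.
have := @uniq_leq_size _ [seq c + k%:R * (h + h) | k <- iota 0 (size r).+1] r.
rewrite size_map size_iota ltnn => H; apply: H.
- rewrite map_inj_uniq ?iota_uniq // => j k /addrI /mulIf.
  by rewrite -mulr2n mulrn_eq0 (negPf h0) => /(_ isT) /eqP; rewrite eqr_nat => /eqP.
- move=> _ /mapP [k _ ->]; rewrite -has_pred1 has_count.
  exact: leq_ltn_trans (leq0n _) (pos k).
Qed.

Section Drinfeld.
Variables (C : numClosedFieldType) (hbar : C).
Hypothesis hbar_neq0 : hbar != 0.

Lemma regular_drinfeld (P : {poly C}) (L : rep (Yangian_sl2 hbar)) c :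
  P \is monic -> is_L P L -> regular (sl2_x hbar) L c <-> ~~ root P c.
Proof.
move=> Pm [irrL [Om [Om0 cyc xOm xiOm]]].
have [r Pr] := closed_field_poly_normal P.
rewrite (monicP Pm) scale1r in Pr.
pose a i := tnth (in_tuple r) i.
have prodE (F : C -> {poly C}) : \prod_i F (a i) = \prod_(z <- r) F z.
  by rewrite [RHS]big_tnth.
have denP : model_den a = P by rewrite Pr -prodE.
have rE : [seq a i | i <- enum 'I_(size r)] = r.
  by rewrite -[RHS]/(tval (in_tuple r)) -[in RHS](map_tnth_enum (in_tuple r)).
have xOm' s : rep_act L (sl2_x hbar true s) Om = 0.
  have := xOm s.+1; rewrite linearZ scale_lfunE => /eqP.
  by rewrite scaler_eq0 (negPf hbar_neq0) => /eqP.
have xiOm' s : rep_act L (sl2_xi hbar s) Om = (line_weight hbar a s).[0] *: Om.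
  have ws : (fun n => rep_act L (xi_series (@sl2_gram C) hbar tt n) Om) =1
      (fun n => weight_series hbar r n *: Om).
    apply: (@series_unique _ _ _ _ r) => n; rewrite -Pr (expansion_lact xiOm).
    transitivity (lpoly (P \Po ('X + hbar%:P)) n *: Om).
      by case: n => [[|k]|k] //=; rewrite scale0r.
    have -> : P \Po ('X + hbar%:P) = \prod_(b <- r) ('X - (b - hbar)%:P).
      rewrite Pr (rmorph_prod (comp_poly ('X + hbar%:P))); apply: eq_bigr => b _ /=.
      by rewrite comp_polyB comp_polyX comp_polyC polyCB opprB addrA.
    rewrite -weight_seriesP -Pr /shact scaler_suml; apply: eq_bigr => j _.
    rewrite -scalerA; congr (_ *: _).
    by case: (iter j nxz n) => [k|k] //=; rewrite scale0r.
  have := ws s.+1; rewrite linearZ scale_lfunE => E.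
  apply: (scalerI hbar_neq0); rewrite scalerA line_weightE mulVKf //.
  rewrite (_ : [seq line_at a 0 i | i <- _] = r) //.
  by rewrite -[RHS]rE; apply: eq_map => i; rewrite line_at0.
have hw := rep_hw_module xOm' xiOm'.
split=> [regc|Pc e]; last first.
  exists P => //; rewrite -denP.
  exact (drinfeld_x_ann hbar_neq0 irrL Om0 cyc hw e).
apply/negP => rootPc.
pose w := bottom_vec (size r) Om.
have w0 : w != 0 := bottom_vec_neq0 hbar_neq0 Om0 hw.
(* These come from the expansion of P(u - hbar)/P(u), the eigenvalue of xi(u) on the bottom
   vector. *)
pose mu k := hbar^-1 * weight_series (- hbar) r k.+1.
have mu_series : eigenvalue_series hbar mu =1 weight_series (- hbar) r.
  by case=> [|k]; rewrite /= ?weight_series0 // mulVKf.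
have Pmu n : shact nxz P (of_series (eigenvalue_series hbar mu)) n =
    lpoly (\prod_(b <- r) ('X - (b + hbar)%:P)) n.
  rewrite -[hbar in RHS]opprK -weight_seriesP -Pr.
  by apply: eq_shact => -[k|k]; rewrite /= ?mu_series.
have xiw s : rep_act L (sl2_xi hbar s) w = mu s *: w.
  have es : eigen_series hbar (@rep_op _ _ L) w =1
      (fun n => (eigenvalue_series hbar mu n : C) *: w).
    apply: (@series_unique _ _ _ _ r) => n; rewrite -Pr -{1}denP.
    rewrite (bottom_vec_series hbar_neq0 irrL Om0 cyc hw) (prodE (fun z => 'X - (z + hbar)%:P)).
    rewrite -Pmu /shact scaler_suml; apply: eq_bigr => j _.
    rewrite -scalerA; congr (_ *: _).
    by case: (iter j nxz n) => [k|k] //=; rewrite scale0r.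
  by have := es s.+1; rewrite /= -scalerA => /(scalerI hbar_neq0).
have [||N bound] := @eigenvalue_bound _ L (rep_act L (sl2_xi hbar 0))
    (fun k => mu 0%N + 2 * k%:R).
- by move=> b u v; rewrite linearP.
- move=> j k /addrI /mulfI; rewrite pnatr_eq0 => /(_ isT) /eqP.
  by rewrite eqr_nat => /eqP.
have [bs [bsP bsE]] := climb irrL Om0 cyc hw w0 xiw bound.
suff cbs : c \in bs by case: (bsP c cbs).
have Plam n : shact nxz P (of_series (eigenvalue_series hbar
    (fun k => (line_weight hbar a k).[0]))) n = lpoly (\prod_(b <- r) ('X - (b - hbar)%:P)) n.
  rewrite -weight_seriesP -Pr; apply: eq_shact => -[[|k]|k] //=.
    by rewrite weight_series0.
  rewrite line_weightE mulVKf // (_ : [seq line_at a 0 i | i <- _] = r) //.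
  by rewrite -[RHS]rE; apply: eq_map => i; rewrite line_at0.
(* Multiplied by P(u), the identity from [climb] becomes one between polynomials, which forces every
   root of P to be among the poles [bs]. *)
apply: (shifted_prod_perm hbar_neq0 (r := r)); last first.
  by rewrite -root_prod_XsubC -Pr.
apply: lpoly_inj => n; rewrite -!lact_lpoly.
rewrite -(eq_shact nxz _ Plam) -(eq_shact nxz _ Pmu).
by rewrite -!shactM ![_ * P]mulrC !shactM; apply: eq_shact.
Qed.

End Drinfeld.

(** * Poles of sl2-modules and the reduction to them *)

Local Open Scope classical_set_scope.

Section SigmaSl2.
Variables (C : numClosedFieldType) (hbar : C).
Hypothesis hbar_neq0 : hbar != 0.
Local Notation Y := (Yangian_sl2 hbar).

(** Stated for filtrations, so as to cover the restriction of a composition series over Y(g), whose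
    subquotients may be reducible over Y(sl2). *)
Lemma sigma_filtration (V : rep Y) N (W : 'I_N -> rep Y) (F : nat -> {vspace V}) :
    F 0%N = 0%VS -> F N = fullv -> (forall k, (k <= N)%N -> subrep (F k)) ->
    (forall k : 'I_N, (F k <= F k.+1)%VS /\ is_subquotient (F k) (F k.+1) (W k)) ->
  sigma V tt = \bigcup_(k in [set: 'I_N]) sigma (W k) tt.
Proof.
move=> F0 FN subF subqF; apply/seteqP; split=> a.
  move/(sigma_sl2P hbar_neq0) => nreg; apply: contrapT => nW; apply: nreg.
  apply/(regular_filtration (Yangian_sl2_relations hbar) a F0 FN subF subqF) => k.
  apply: contrapT => nreg; apply: nW; exists k => //.
  exact/(sigma_sl2P hbar_neq0).
move=> [k _ /(sigma_sl2P hbar_neq0) nreg]; apply/(sigma_sl2P hbar_neq0) => reg.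
apply: nreg.
exact: (regular_filtration (Yangian_sl2_relations hbar) a F0 FN subF subqF).1 reg k.
Qed.

Lemma sigma_iso (W L : rep Y) : rep_iso W L -> sigma W tt = sigma L tt.
Proof.
move=> [f [kerf imf fM]].
have f_inj : injective f by apply/lker0P; rewrite kerf.
have E q e : ann S q (rep_act W \o sl2_x hbar e) <-> ann S q (rep_act L \o sl2_x hbar e).
  split=> qW n; rewrite shact_linear; apply/lfunP => v; rewrite zero_lfunE.
    have /memv_imgP [w _ ->] : v \in limg f by rewrite imf memvf.
    by rewrite -fM -(shact_linear S (rep_act W)) qW zero_lfunE linear0.
  by apply: f_inj; rewrite fM -(shact_linear S (rep_act L)) qW zero_lfunE linear0.
suff H a : regular (sl2_x hbar) W a <-> regular (sl2_x hbar) L a.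
  by apply/seteqP; split=> a /(sigma_sl2P hbar_neq0) nreg;
    apply/(sigma_sl2P hbar_neq0) => /H.
by split=> reg e; have [q qa /E qx] := reg e; exists q.
Qed.

Lemma sigma_drinfeld (P : {poly C}) (W : rep Y) :
  drinfeld_polynomial P W -> sigma W tt = [set a | root P a].
Proof.
move=> [Pm [L [LP /sigma_iso ->]]]; apply/seteqP; split=> a /=.
  move/(sigma_sl2P hbar_neq0) => nreg; apply: contrapT => /negP Pa.
  exact/nreg/(regular_drinfeld hbar_neq0 a Pm LP).
move=> Pa; apply/(sigma_sl2P hbar_neq0) => /(regular_drinfeld hbar_neq0 a Pm LP).
by rewrite Pa.
Qed.

End SigmaSl2.

(** The homomorphism [phi] preserves xi(u) and multiplies x^+(u) and x^-(u) by the nonzero number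
    [sqrtC (dsym B i)], which moves no pole. *)
Lemma sigma_pullback (C : numClosedFieldType) (I : finType) (B : I -> I -> C)
    (hbar : C) (i : I) (Bi : B i i != 0) (V : rep (Yangian B hbar)) :
  sigma (pullback (phi hbar Bi) V) tt = sigma V i.
Proof.
have d0 : sqrtC (dsym B i) != 0 by rewrite sqrtC_eq0 dsym_neq0.
have poleZ (X X' : nat -> 'End(V)) c a : c != 0 -> (forall r, X r = c *: X' r) ->
    is_pole X a <-> is_pole X' a.
  move=> c0 XX'; rewrite !is_poleE -(pole_scale (fun n => X' n.+1) a c0).
  by apply: eq_pole => q; split; apply: ann_eq => n; rewrite XX'.
have xiE a := poleZ (fun r => rep_act (pullback (phi hbar Bi) V) (xi_series _ _ tt r))
  (fun r => rep_act V (xi_series B hbar i r)) 1 a.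
have xE e a := poleZ (fun r => rep_act (pullback (phi hbar Bi) V) (x_series _ _ e tt r))
  (fun r => rep_act V (x_series B hbar e i r)) _ a d0.
have xi1 r : rep_act (pullback (phi hbar Bi) V) (xi_series _ _ tt r) =
    1 *: rep_act V (xi_series B hbar i r).
  by rewrite scale1r -(phi_xi_series hbar Bi).
have x1 e r : rep_act (pullback (phi hbar Bi) V) (x_series _ _ e tt r) =
    sqrtC (dsym B i) *: rep_act V (x_series B hbar e i r).
  by rewrite -linearZ -(phi_x_series hbar Bi).
apply/seteqP; split=> a [p|[e p]]; [left|right; exists e|left|right; exists e].
- exact/(xiE a (oner_neq0 _) xi1).
- exact/(xE e a (x1 e)).
- exact/(xiE a (oner_neq0 _) xi1).
- exact/(xE e a (x1 e)).
Qed.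

Theorem corollary6p4 (R : realType) (g : lieAlgebra R[i]) (h : {vspace g})
    (I : finType) (alpha : I -> 'Hom(subvs_of h, R[i]^o))
    (kappa : g -> g -> R[i])
    (simple_g : simple_lie g) (cartan_h : cartan_subalgebra h)
    (simple_alpha : simple_roots alpha)
    (normalized_kappa : normalized_form h kappa)
    (hbar : R[i]) (hbar_neq0 : hbar != 0)
    (V : rep (Yangian (gram kappa alpha) hbar)) (i : I) :
  (forall (N : nat) (W : 'I_N -> rep (Yangian (gram kappa alpha) hbar)),
     composition_factors V W ->
     sigma V i = \bigcup_(k in [set: 'I_N]) sigma (W k) i) /\
  (forall (M : nat)
      (W : 'I_M -> rep (Yangian_sl2 (dsym (gram kappa alpha) i * hbar))),
     composition_factors
       (pullback (phi hbar (gram_neq0 simple_alpha normalized_kappa i)) V) W ->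
     sigma V i = \bigcup_(k in [set: 'I_M]) sigma (W k) tt /\
     forall P : 'I_M -> {poly R[i]},
       (forall k, drinfeld_polynomial (P k) (W k)) ->
       \bigcup_(k in [set: 'I_M]) sigma (W k) tt =
       \bigcup_(k in [set: 'I_M]) [set a | root (P k) a]).
Proof.
have Bi := gram_neq0 simple_alpha normalized_kappa i.
have dh : dsym (gram kappa alpha) i * hbar != 0 by rewrite mulf_neq0 // dsym_neq0.
split=> [N W [F [F0 FN subF facF]]|M W [F [F0 FN subF facF]]].
  (* The composition series over Y(g) is restricted along [phi]; the poles of each restricted factor
     are those of the factor itself. *)
  rewrite -(sigma_pullback Bi) (sigma_filtration dh (W := fun k => pullback (phi hbar Bi) (W k))
    (F := F : nat -> {vspace pullback (phi hbar Bi) V})) //.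
  - by apply: eq_bigcupr => k _; rewrite sigma_pullback.
  - by move=> k kN y v; apply: subF.
  - move=> k; have [FS _ [f [fU fK fM]]] := facF k; split=> //.
    by exists f; split=> // y v; apply: fM.
split=> [|P PW].
  rewrite -(sigma_pullback (gram_neq0 simple_alpha normalized_kappa i)).
  by apply: (sigma_filtration dh F0 FN subF) => k; have [] := facF k.
by apply: eq_bigcupr => k _; apply: sigma_drinfeld.
Qed.
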